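(* Let $\mathbb{K}=\mathbb{C}[t^{\pm1}]$. As objects of $\mathbf{Fct}(\boldsymbol{\beta},\mathbb{K}\text{-}\mathfrak{Mod})$, $$t^{-1}\mathbf{LM}_1(t\mathfrak{X})=\mathfrak{Bur}_{t^2},$$ where for each $n$ the module $\mathbf{LM}_1(t\mathfrak{X})(n)=\mathcal{I}_{\mathbb{K}[\mathbf{F}_n]}\otimes_{\mathbb{K}[\mathbf{F}_n]}\mathbb{K}$ is identified with $\mathbb{K}^{\oplus n}$ via the isomorphism $\Lambda_n:(g_k-1)\otimes v\mapsto(0,\dots,0,v,0,\dots,0)$ ($v$ in the $k$-th place).
   Context: $\mathbb{N}=\{0,1,2,\dots\}$; $\mathbf{Fct}(\mathfrak{C},\mathfrak{D})$ is the category of functors. $\mathbf{B}_n$ is the braid group on $n$ strands with Artin generators $\sigma_1,\dots,\sigma_{n-1}$ ($\mathbf{B}_0,\mathbf{B}_1$ trivial), product also written $\circ$, read from right to left. $\boldsymbol{\beta}$ is the groupoid with objects $\mathbb{N}$, $\mathrm{Hom}(n,n)=\mathbf{B}_n$ and no morphisms between distinct objects; $id_1\natural-:\mathbf{B}_n\to\mathbf{B}_{n+1}$ sends $\sigma_i$ to $\sigma_{i+1}$. $\mathbf{F}_n=\langle g_1,\dots,g_n\rangle$ is the free group. $\varsigma_{n,1}:\mathbf{F}_n\to\mathbf{B}_{n+1}$ is given by $g_1\mapsto\sigma_1^2$ and $g_i\mapsto\sigma_1^{-1}\circ\cdots\circ\sigma_{i-1}^{-1}\circ\sigma_i^2\circ\sigma_{i-1}\circ\cdots\circ\sigma_1$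 for $2\le i\le n$ ($\varsigma_{0,1}$ trivial). $a_{n,1}:\mathbf{B}_n\to\mathrm{Aut}(\mathbf{F}_n)$ is the Artin representation: $a_{n,1}(\sigma_i)$ sends $g_i\mapsto g_{i+1}$, $g_{i+1}\mapsto g_{i+1}^{-1}g_ig_{i+1}$, and $g_j\mapsto g_j$ for $j\notin\{i,i+1\}$. $\mathcal{I}_{\mathbb{K}[\mathbf{F}_n]}$ is the augmentation ideal of $\mathbb{K}[\mathbf{F}_n]$, a free right $\mathbb{K}[\mathbf{F}_n]$-module with basis $\{g_k-1\}_{1\le k\le n}$, with the induced action of $\mathbf{B}_n$ through $a_{n,1}$. The Long-Moody functor $\mathbf{LM}_1$, as an endofunctor of $\mathbf{Fct}(\boldsymbol{\beta},\mathbb{K}\text{-}\mathfrak{Mod})$, is $\mathbf{LM}_1(F)(n)=\mathcal{I}_{\mathbb{K}[\mathbf{F}_n]}\otimes_{\mathbb{K}[\mathbf{F}_n]}F(n+1)$, where $\mathbf{F}_n$ acts on $F(n+1)$ via $\varsigma_{n,1}$, with $\mathbf{LM}_1(F)(\sigma)(i\otimes v)=a_{n,1}(\sigma)(i)\otimes F(id_1\natural\sigma)(v)$ for $\sigma\in\mathbf{B}_n$. For an invertible $y\in\mathbb{K}$, $y\mathfrak{X}:\boldsymbol{\beta}\to\mathbb{K}\text{-}\mathfrak{Mod}$ is the functor with $y\mathfrak{X}(n)=\mathbb{K}$ for all $n$ and every Artin generator acting by multiplication by $y$; for $F:\boldsymbol{\beta}\to\mathbb{K}\text{-}\mathfrak{Mod}$,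 $yF:=y\mathfrak{X}\otimes_{\mathbb{K}}F$. $\mathfrak{Bur}_{t^2}:\boldsymbol{\beta}\to\mathbb{K}\text{-}\mathfrak{Mod}$ sends $n$ to $\mathbb{K}^{\oplus n}$ and, for $n\ge2$, $\sigma_i\in\mathbf{B}_n$ to $Id_{i-1}\oplus\begin{bmatrix}0&t^2\\1&1-t^2\end{bmatrix}\oplus Id_{n-i-1}$. *)

(* Defs.v *)
From HB Require Import structures.
From mathcomp Require Import all_boot all_order all_algebra.
From mathcomp Require Import finmap monalg complex.
From mathcomp Require Import boolp reals.
From mathcomp Require Import ring.

Set Implicit Arguments.
Unset Strict Implicit.
Unset Printing Implicit Defensive.

Import GRing.Theory.
Local Open Scope ring_scope.
Local Open Scope quotient_scope.

Section Words.
Variable X : choiceType.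

(* The letter (x, false) stands for the generator x, (x, true) for x^-1. *)
Definition letter : Type := (X * bool)%type.
Definition word : Type := seq (X * bool).
Definition linv (l : letter) : letter := (l.1, ~~ l.2).

Section Eval.
Variables (T : Type) (op : T -> T -> T) (e : T) (f : letter -> T).

Definition weval (w : word) : T := foldr (fun l => op (f l)) e w.

End Eval.

Variable R : word -> word -> Prop.

Inductive wcong : word -> word -> Prop :=
| WcongRefl u : wcong u u
| WcongSym u v : wcong u v -> wcong v u
| WcongTrans u v w : wcong u v -> wcong v w -> wcong u w
| WcongCat u u' v v' : wcong u u' -> wcong v v' -> wcong (u ++ v) (u' ++ v')
| WcongCancel l : wcong [:: l; linv l] [::]
| WcongRel u v : R u v -> wcong u v.

Definition wcongb (u v : word) : bool := `[< wcong u v >].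

Fact wcongb_refl : reflexive wcongb.
Proof. by move=> u; apply/asboolP; constructor. Qed.
Fact wcongb_sym : symmetric wcongb.
Proof. by move=> u v; apply/idP/idP => /asboolP h; apply/asboolP/WcongSym. Qed.
Fact wcongb_trans : transitive wcongb.
Proof.
by move=> v u w /asboolP h /asboolP h'; apply/asboolP/(WcongTrans h h').
Qed.

Canonical wcong_equiv := EquivRel wcongb wcongb_refl wcongb_sym wcongb_trans.

Definition pres : Type := {eq_quot wcong_equiv}.
HB.instance Definition _ := Choice.on pres.
HB.instance Definition _ := EqQuotient.on pres.

Definition wclass (w : word) : pres := \pi_pres w.

Lemma wclassP u v : wclass u = wclass v <-> wcong u v.
Proof.
split=> [/eqP|h]; last by apply/eqP; rewrite eqmodE; apply/asboolP.
by rewrite eqmodE => /asboolP.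
Qed.

Lemma wclassK (x : pres) : wclass (repr x) = x.
Proof. exact: reprK. Qed.

Lemma repr_wclass w : wcong (repr (wclass w)) w.
Proof. by apply/wclassP; rewrite wclassK. Qed.

Definition winv (w : word) : word := rev (map linv w).

Lemma linvK : involutive linv.
Proof. by case=> x b; rewrite /linv /= negbK. Qed.

Lemma wcong_winvr w : wcong (w ++ winv w) [::].
Proof.
elim: w => [|l w ih]; first exact: WcongRefl.
rewrite /winv /= rev_cons -cats1 catA.
apply: (@WcongTrans _ ([:: l] ++ ([::] ++ [:: linv l]))); last exact: WcongCancel.
rewrite -cat_cons -(cat1s l) -!catA; apply: WcongCat; first exact: WcongRefl.
by rewrite catA; apply: WcongCat => //; exact: WcongRefl.
Qed.

Lemma winvK : involutive winv.
Proof.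
by move=> w; rewrite /winv map_rev revK -map_comp map_id_in // => l _; apply: linvK.
Qed.

Lemma wcong_winvl w : wcong (winv w ++ w) [::].
Proof. by rewrite -{2}(winvK w); apply: wcong_winvr. Qed.

Lemma wcong_winv u v : wcong u v -> wcong (winv u) (winv v).
Proof.
move=> uv; apply: (@WcongTrans _ (winv u ++ (v ++ winv v))).
  rewrite -[X in wcong X]cats0; apply: WcongCat; first exact: WcongRefl.
  exact/WcongSym/wcong_winvr.
apply: (@WcongTrans _ ((winv u ++ u) ++ winv v)).
  rewrite catA; apply: WcongCat; last exact: WcongRefl.
  by apply: WcongCat; [exact: WcongRefl | exact: WcongSym].
by rewrite -[X in wcong _ X]cat0s; apply: WcongCat; [exact: wcong_winvl | exact: WcongRefl].
Qed.

Definition pone : pres := wclass [::].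
Definition pmul (x y : pres) : pres := wclass (repr x ++ repr y).
Definition pinv (x : pres) : pres := wclass (winv (repr x)).

Lemma pmulE u v : pmul (wclass u) (wclass v) = wclass (u ++ v).
Proof. by apply/wclassP/WcongCat; apply: repr_wclass. Qed.

Lemma pinvE u : pinv (wclass u) = wclass (winv u).
Proof. exact/wclassP/wcong_winv/repr_wclass. Qed.

Fact pmulA : associative pmul.
Proof.
by move=> x y z; rewrite -(wclassK x) -(wclassK y) -(wclassK z) !pmulE catA.
Qed.
Fact pmul1 : left_id pone pmul.
Proof. by move=> x; rewrite -(wclassK x) pmulE. Qed.
Fact pmulr1 : right_id pone pmul.
Proof. by move=> x; rewrite -(wclassK x) pmulE cats0. Qed.
Fact pmulV : left_inverse pone pinv pmul.
Proof.
by move=> x; rewrite -(wclassK x) pinvE pmulE; apply/wclassP/wcong_winvl.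
Qed.
Fact pmulrV : right_inverse pone pinv pmul.
Proof.
by move=> x; rewrite -(wclassK x) pinvE pmulE; apply/wclassP/wcong_winvr.
Qed.

HB.instance Definition _ :=
  isGroup.Build pres pmulA pmul1 pmulr1 pmulV pmulrV.

Definition pgen (x : X) : pres := wclass [:: (x, false)].

Lemma wclass_cons l w : wclass (l :: w) = (wclass [:: l] * wclass w)%g.
Proof. by rewrite [RHS]pmulE. Qed.

Lemma wclassV x : wclass [:: (x, true)] = ((pgen x)^-1)%g.
Proof. by rewrite [RHS]pinvE. Qed.

Lemma pres_ind (P : pres -> Prop) :
  P 1%g -> (forall x y, P y -> P (pgen x * y)%g) ->
  (forall x y, P y -> P ((pgen x)^-1 * y)%g) -> forall x, P x.
Proof.
move=> P1 Pg PV x; rewrite -(wclassK x); elim: (repr x) => [|[z b] w ih] //.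
by rewrite wclass_cons; case: b; [rewrite wclassV; apply: PV | apply: Pg].
Qed.

Section EvalTheory.
Variables (T : Type) (op : T -> T -> T) (e : T) (f : letter -> T).
Hypotheses (opA : associative op) (op1 : left_id e op) (opr1 : right_id e op).
Hypothesis fV : forall l, op (f l) (f (linv l)) = e.
Hypothesis fR : forall u v, R u v -> weval op e f u = weval op e f v.

Lemma weval_cat u v :
  weval op e f (u ++ v) = op (weval op e f u) (weval op e f v).
Proof. by elim: u => [|l u ih] /=; rewrite ?op1 // ih opA. Qed.

Lemma weval_cong u v : wcong u v -> weval op e f u = weval op e f v.
Proof.
move=> h; elim: h => //= [? ? ? _ -> _ -> //|? ? ? ? _ h1 _ h2 | l].
  by rewrite !weval_cat h1 h2.
by rewrite opr1 fV.
Qed.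

Lemma weval_class u : weval op e f (repr (wclass u)) = weval op e f u.
Proof. exact/weval_cong/repr_wclass. Qed.

Lemma weval_mul (x y : pres) : weval op e f (repr (x * y)%g) =
  op (weval op e f (repr x)) (weval op e f (repr y)).
Proof. by rewrite weval_class weval_cat. Qed.

Lemma weval_one : weval op e f (repr (1%g : pres)) = e.
Proof. by rewrite weval_class. Qed.

Lemma weval_gen x : weval op e f (repr (pgen x)) = f (x, false).
Proof. by rewrite weval_class /= opr1. Qed.

End EvalTheory.

Section GroupLift.
Variables (G : groupType) (h : X -> G).

Definition lval (l : letter) : G := if l.2 then ((h l.1)^-1)%g else h l.1.

Definition glift (x : pres) : G := weval *%g 1%g lval (repr x).

Hypothesis hR : forall u v, R u v -> weval *%g 1%g lval u = weval *%g 1%g lval v.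

Lemma lvalV l : (lval l * lval (linv l))%g = 1%g.
Proof. by case: l => x [] /=; rewrite /lval /= ?mulVg ?mulgV. Qed.

Lemma gliftM : {morph glift : x y / (x * y)%g}.
Proof. move=> x y; apply: weval_mul => //; [exact: mulgA|exact: mul1g|exact: mulg1|exact: lvalV]. Qed.

Lemma glift_gen x : glift (pgen x) = h x.
Proof. apply: weval_gen => //; [exact: mulgA|exact: mul1g|exact: mulg1|exact: lvalV]. Qed.

End GroupLift.

End Words.

Definition norel (X : choiceType) (u v : word X) : Prop := False.
Definition free_group (X : choiceType) : Type := pres (@norel X).
HB.instance Definition _ X := Group.on (free_group X).
HB.instance Definition _ X := EqQuotient.on (free_group X).

Section FreeLift.
Variables (X : choiceType) (G : groupType) (h : X -> G).

Definition free_lift (x : free_group X) : G := glift h x.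

Lemma free_liftM : {morph free_lift : x y / (x * y)%g}.
Proof. exact: gliftM. Qed.

HB.instance Definition _ :=
  monoid.isMultiplicative.Build (free_group X) G free_lift free_liftM.

Lemma free_lift_gen x : free_lift (pgen _ x) = h x.
Proof. exact: glift_gen. Qed.

End FreeLift.

Section Mult.
Variables (G H : groupType) (f : {multiplicative G -> H}).
Lemma multM x y : f (x * y)%g = (f x * f y)%g.
Proof. exact: gmulfM. Qed.
Lemma mult1 : f 1%g = 1%g.
Proof. by apply: (mulgI (f 1%g)); rewrite -multM !mulg1. Qed.
Lemma multV x : f x^-1%g = ((f x)^-1)%g.
Proof. by apply: (mulgI (f x)); rewrite -multM !mulgV mult1. Qed.
End Mult.

Lemma free_ext (X : choiceType) (G : groupType)
    (f g : {multiplicative (free_group X) -> G}) :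
  (forall x, f (pgen _ x) = g (pgen _ x)) -> f =1 g.
Proof.
move=> fg; apply: pres_ind => [|x y ih|x y ih]; first by rewrite !mult1.
  by rewrite !multM fg ih.
by rewrite !multM !multV fg ih.
Qed.

Notation "''F^' n" := (free_group 'I_n) (at level 8, n at level 2).

(* Indices start at 0: [sigma i] with [i : 'I_n.-1] is the Artin generator
   usually written sigma_{i+1}, and it involves the strands [lo i], [hi i]. *)
Inductive braid_rel (n : nat) : word 'I_n.-1 -> word 'I_n.-1 -> Prop :=
| BraidRel (i j : 'I_n.-1) : j = i.+1 :> nat ->
    braid_rel [:: (i, false); (j, false); (i, false)]
              [:: (j, false); (i, false); (j, false)]
| BraidComm (i j : 'I_n.-1) : (i.+1 < j)%N ->
    braid_rel [:: (i, false); (j, false)] [:: (j, false); (i, false)].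

Definition braid (n : nat) : Type := pres (@braid_rel n).
HB.instance Definition _ n := Group.on (braid n).
HB.instance Definition _ n := EqQuotient.on (braid n).
Notation "''B^' n" := (braid n) (at level 8, n at level 2).

Definition sigma (n : nat) (i : 'I_n.-1) : 'B^n := pgen _ i.

Section LoHi.
Variables (n : nat) (i : 'I_n.-1).
Fact hi_subproof : (i.+1 < n)%N. Proof. by case: n i => [[]|m []] //. Qed.
Definition lo : 'I_n := widen_ord (leq_pred n) i.
Definition hi : 'I_n := Ordinal hi_subproof.
Lemma lo_hi : (lo == hi) = false.
Proof. by rewrite -val_eqE /= ltn_eqF. Qed.
Lemma hi_lo : (hi == lo) = false.
Proof. by rewrite eq_sym lo_hi. Qed.
End LoHi.

Definition fgen (n : nat) (k : 'I_n) : 'F^n := pgen _ k.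

Section ArtinGenerator.
Variables (n : nat) (i : 'I_n.-1).

Definition artin_gen_val (k : 'I_n) : 'F^n :=
  if k == lo i then fgen (hi i)
  else if k == hi i then ((fgen (hi i))^-1 * fgen (lo i) * fgen (hi i))%g
  else fgen k.

Definition artin_gen_inv_val (k : 'I_n) : 'F^n :=
  if k == lo i then (fgen (lo i) * fgen (hi i) * (fgen (lo i))^-1)%g
  else if k == hi i then fgen (lo i)
  else fgen k.

Definition artin_gen : {multiplicative 'F^n -> 'F^n} :=
  free_lift artin_gen_val.
Definition artin_gen_inv : {multiplicative 'F^n -> 'F^n} :=
  free_lift artin_gen_inv_val.

End ArtinGenerator.

(* Extended by 1 outside the range of indices, which avoids casts below. *)
Definition sigman (n k : nat) : 'B^n :=
  if insub k is Some i then sigma i else 1%g.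

Section Sigman.
Variable n : nat.
Local Open Scope group_scope.
Local Notation s := (sigman n).

Lemma sigman_ord (i : 'I_n.-1) : s i = sigma i.
Proof. by rewrite /sigman valK. Qed.

Lemma sigman_comm j k : (j.+1 < k)%N -> s j * s k = s k * s j.
Proof.
rewrite /sigman => jk; case: insubP => [j' _ ej|]; last by rewrite mul1g mulg1.
case: insubP => [k' _ ek|]; last by rewrite mul1g mulg1.
rewrite [LHS]pmulE [RHS]pmulE; apply/wclassP/WcongRel/BraidComm.
by rewrite ej ek.
Qed.

Lemma sigman_braid k : (k.+2 < n)%N ->
  s k * s k.+1 * s k = s k.+1 * s k * s k.+1.
Proof.
move=> kn; rewrite /sigman.
have h1 : (k.+1 < n.-1)%N by case: n kn.
rewrite !insubT //= => [|h0]; first exact: ltnW.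
have E u v w : wclass (@braid_rel n) u * wclass _ v * wclass _ w =
    wclass _ (u ++ v ++ w) by rewrite [(wclass _ u * _)%g]pmulE [LHS]pmulE catA.
rewrite !E; apply/wclassP/WcongRel; exact: BraidRel.
Qed.

End Sigman.

(* The map id_1 \natural - sending sigma_i to sigma_{i+1}; [hi i : 'I_n] has
   value i + 1 and indexes a generator of 'B^n.+1 because n.+1.-1 reduces to n. *)
Definition shift_fun (n : nat) : 'B^n -> 'B^n.+1 :=
  glift (fun i : 'I_n.-1 => sigma (n := n.+1) (hi i)).

Lemma shift_resp n u v : @braid_rel n u v ->
  let f := lval (fun i : 'I_n.-1 => sigma (n := n.+1) (hi i)) in
  weval *%g 1%g f u = weval *%g 1%g f v.
Proof.
case; rewrite /lval /=.
  move=> i j ij; rewrite !mulg1 !mulgA -!sigman_ord /= ij.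
  by apply: sigman_braid; rewrite ltnS -ij; apply: hi_subproof.
by move=> i j ij; rewrite !mulg1 -!sigman_ord; apply: sigman_comm.
Qed.

Lemma shift_funM n : {morph @shift_fun n : x y / (x * y)%g}.
Proof.
apply: gliftM => u v; exact: shift_resp.
Qed.
HB.instance Definition _ n :=
  monoid.isMultiplicative.Build 'B^n 'B^n.+1 (@shift_fun n) (@shift_funM n).
Definition shift n : {multiplicative 'B^n -> 'B^n.+1} := @shift_fun n.

Lemma shift_gen n (i : 'I_n.-1) : shift n (sigma i) = sigman n.+1 i.+1.
Proof.
rewrite -[i.+1]/(nat_of_ord (hi i : 'I_n.+1.-1)) sigman_ord.
apply: glift_gen => u v; exact: (@shift_resp n u v).
Qed.

(* With indices from 0: sigma_0^-1 ... sigma_{k-1}^-1 sigma_k^2 sigma_{k-1} ... sigma_0. *)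
Definition varsigma_gen (n : nat) (k : 'I_n) : 'B^n.+1 :=
  ((\prod_(j <- iota 0 k) (sigman n.+1 j)^-1) * (sigman n.+1 k) ^+ 2 *
   (\prod_(j <- rev (iota 0 k)) sigman n.+1 j))%g.

Definition varsigma (n : nat) : {multiplicative 'F^n -> 'B^n.+1} :=
  free_lift (@varsigma_gen n).

Section GroupWords.
Variable G : groupType.
Local Open Scope group_scope.
Implicit Types a b v t : G.

Lemma commVg v b : v * b = b * v -> v^-1 * b = b * v^-1.
Proof. by move=> h; apply: (mulgI v); rewrite mulgA mulgV mul1g mulgA h mulgK. Qed.

Lemma artin_word_lo a b v : a * b * a = b * a * b -> v * b = b * v ->
  (a * v)^-1 * b ^+ 2 * (a * v) * b = b * (v^-1 * a ^+ 2 * v).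
Proof.
move=> hab hv; have habt t : a * (b * (a * t)) = b * (a * (b * t)).
  by rewrite !mulgA hab.
rewrite [RHS]mulgA [in RHS]mulgA -(commVg hv).
apply: (mulgI (a * v)); rewrite !expg2 -!mulgA.
by rewrite mulgA mulVKg -?mulgA // mulVKg hv -!habt.
Qed.

Lemma artin_word_hi a b v : a * b * a = b * a * b -> v * b = b * v ->
  let p := v^-1 * a ^+ 2 * v in let q := b * p * b^-1 in
  q^-1 * p * q * b = b * q.
Proof.
move=> hab hv p q; have habt t : a * (b * (a * t)) = b * (a * (b * t)).
  by rewrite !mulgA hab.
have pt t : v * (p * t) = a * (a * (v * t)).
  by rewrite /p expg2 !mulgA mulgV mul1g.
have bt t : v * (b * t) = b * (v * t) by rewrite !mulgA hv.
have pbpb : p * (b * (p * b)) = b * (p * (b * p)).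
  apply: (mulgI v); rewrite pt bt pt hv bt pt bt -[p]mulg1 pt mulg1.
  by rewrite [in LHS]habt [in LHS]habt [in RHS]habt [in RHS](habt v).
have qb : q * b = b * p by rewrite /q mulgVK.
clearbody q p; apply: (mulgI q); apply: (mulIg b).
have -> : q * (q^-1 * p * q * b) = p * (q * b) by rewrite !mulgA mulgV mul1g.
by rewrite qb -!mulgA pbpb qb !mulgA qb -!mulgA.
Qed.
End GroupWords.

Section Equivariance.
Variable n : nat.
Local Open Scope group_scope.
Local Notation s := (sigman n.+1).
Let w k := \prod_(j <- rev (iota 0 k)) s j.
Let c k := (w k)^-1 * s k ^+ 2 * w k.

Let iotaS k : iota 0 k.+1 = iota 0 k ++ [:: k].
Proof. by rewrite -[k.+1]addn1 iotaD. Qed.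
Let w0 : w 0 = 1. Proof. by rewrite /w big_nil. Qed.
Let wS k : w k.+1 = s k * w k.
Proof. by rewrite /w iotaS rev_cat big_cat /= big_seq1. Qed.
Let wV k : (w k)^-1 = \prod_(j <- iota 0 k) (s j)^-1.
Proof.
elim: k => [|k ih]; first by rewrite w0 big_nil invg1.
by rewrite wS invgM ih iotaS big_cat /= big_seq1.
Qed.

Lemma varsigma_fgen (k : 'I_n) : varsigma n (fgen k) = c k.
Proof. by rewrite [LHS]free_lift_gen /varsigma_gen -wV. Qed.

Let comm_w a k : (forall j, (j < k)%N -> s j * a = a * s j) -> w k * a = a * w k.
Proof.
elim: k => [|k ih] h; first by rewrite w0 mul1g mulg1.
by rewrite wS -mulgA ih ?mulgA ?h // => j jk; apply: h; apply: ltnW.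
Qed.

Let comm_c a k : w k * a = a * w k -> s k * a = a * s k -> c k * a = a * c k.
Proof.
move=> h1 h2; rewrite /c expg2 -!mulgA h1 (mulgA (s k) a) h2.
by rewrite -(mulgA a) (mulgA (s k) a) h2 !mulgA (commVg h1).
Qed.

Let aba (i : nat) : (i.+1 < n)%N -> s i * s i.+1 * s i = s i.+1 * s i * s i.+1.
Proof. by move=> h; apply: sigman_braid. Qed.

Let w_b i : w i * s i.+1 = s i.+1 * w i.
Proof. by apply: comm_w => j ji; rewrite sigman_comm. Qed.

Let eq_lt (i k : nat) : (k < i)%N -> c k * s i.+1 = s i.+1 * c k.
Proof.
move=> ki; apply: comm_c; last by rewrite sigman_comm.
by apply: comm_w => j jk; rewrite sigman_comm // ltnS (ltn_trans jk).
Qed.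

Let eq_lo (i : nat) : (i.+1 < n)%N -> c i.+1 * s i.+1 = s i.+1 * c i.
Proof. by move=> h; rewrite /c wS; apply: artin_word_lo; [exact: aba|exact: w_b]. Qed.

Let eq_hi (i : nat) : (i.+1 < n)%N ->
  (c i.+1)^-1 * c i * c i.+1 * s i.+1 = s i.+1 * c i.+1.
Proof.
move=> h; rewrite (_ : c i.+1 = s i.+1 * c i * (s i.+1)^-1); last first.
  by rewrite -eq_lo // mulgK.
by apply: artin_word_hi; [exact: aba|exact: w_b].
Qed.

Let w_a i : (i.+1 < n)%N -> forall k, (i.+1 < k)%N -> w k * s i.+1 = s i * w k.
Proof.
move=> h; elim=> // k ih; rewrite ltnS leq_eqVlt => /orP[/eqP<-|ik].
  by rewrite !wS -!mulgA w_b !mulgA aba.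
by rewrite wS -mulgA ih // !mulgA -(sigman_comm _ ik) .
Qed.

Let eq_gt i k : (i.+1 < n)%N -> (i.+1 < k)%N -> c k * s i.+1 = s i.+1 * c k.
Proof.
move=> h ik; have A := w_a h ik; have B := sigman_comm n.+1 ik.
have A' : (w k)^-1 * s i = s i.+1 * (w k)^-1.
  by apply: (mulgI (w k)); rewrite mulgA mulgV mul1g mulgA A mulgK.
rewrite /c expg2 -!mulgA A (mulgA (s k) (s i)) -B.
by rewrite -(mulgA (s i)) (mulgA (s k) (s i)) -B !mulgA A'.
Qed.

Lemma equivariance_gen (i : 'I_n.-1) g :
  varsigma n (artin_gen i g) * s i.+1 = s i.+1 * varsigma n g.
Proof.
have hin : (i.+1 < n)%N := hi_subproof i.
have K k : varsigma n (artin_gen i (fgen k)) * s i.+1 =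
    s i.+1 * varsigma n (fgen k).
  rewrite [artin_gen i _]free_lift_gen /artin_gen_val.
  case: (eqVneq k (lo i)) => [->|klo]; first by rewrite !varsigma_fgen; apply: eq_lo.
  case: (eqVneq k (hi i)) => [->|khi].
    by rewrite !multM multV !varsigma_fgen; apply: eq_hi.
  rewrite varsigma_fgen; case: (ltngtP k i) => [ki|ik|E].
  - exact: eq_lt.
  - by apply: eq_gt => //; rewrite ltn_neqAle ik eq_sym -[i.+1]/(val (hi i)) val_eqE khi.
  - by case/eqP: klo; apply: val_inj.
move: g; apply: pres_ind => [|k y ih|k y ih]; first by rewrite !mult1 mul1g mulg1.
  by rewrite !multM -mulgA ih !mulgA K.
rewrite !multM !multV -mulgA ih !mulgA; congr (_ * _).
by apply: (mulgI (varsigma n (artin_gen i (fgen k)))); rewrite mulgA mulgV mul1g mulgA K mulgK.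
Qed.

End Equivariance.

Definition mklin (K : pzRingType) (U V : lmodType K) (f : U -> V)
    (fL : linear f) : {linear U -> V} :=
  HB.pack f (GRing.isLinear.Build K U V *:%R f fL).

Lemma linear_eq (K : pzRingType) (U V : lmodType K) (f g : {linear U -> V}) :
  f =1 g -> f = g.
Proof.
case: f g => [f [[fa] [fs]]] [g [[ga] [gs]]] /= /funext fg.
case: _ / fg ga gs => ga gs.
by rewrite (Prop_irrelevance fa ga) (Prop_irrelevance fs gs).
Qed.

Section FreeModule.
Variables (K : comNzRingType) (T : choiceType).
Implicit Types (x y : {malg K[T]}).

Section Ext.
Variable W : lmodType K.
Implicit Type h : T -> W.

(* {malg K[T]} serves as the free K-module on T; [mext h] is the K-linear
   extension of [h]. *)
Definition mext h x : W := \sum_(k <- msupp x) x@_k *: h k.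

Lemma mextEw h x (d : {fset T}) : (msupp x `<=` d)%fset ->
  mext h x = \sum_(k <- d) x@_k *: h k.
Proof.
move=> le; rewrite /mext (big_fset_incl _ le) //= => k _ /mcoeff_outdom ->.
by rewrite scale0r.
Qed.

Lemma mext_linear h : linear (mext h).
Proof.
move=> a x y; pose d := (msupp x `|` msupp y)%fset.
have dx : (msupp x `<=` d)%fset := fsubsetUl _ _.
have dy : (msupp y `<=` d)%fset := fsubsetUr _ _.
have daxy : (msupp (a *: x + y) `<=` d)%fset.
  apply: fsubset_trans (msuppD_le _ _) _; apply: fsetSU; exact: msuppZ_le.
rewrite (mextEw h dx) (mextEw h dy) (mextEw h daxy) scaler_sumr -big_split /=.
by apply: eq_bigr => k _; rewrite mcoeffD mcoeffZ scalerDl scalerA.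
Qed.
HB.instance Definition _ h :=
  GRing.isLinear.Build K {malg K[T]} W *:%R (mext h) (mext_linear h).

Lemma mextU h c k : mext h << c *g k >> = c *: h k.
Proof. by rewrite (mextEw h msuppU_le) big_seq_fset1 mcoeffUU. Qed.

Lemma mextU1 h k : mext h << k >> = h k.
Proof. by rewrite mextU scale1r. Qed.

Lemma mextZD h h' a x :
  mext (fun k => a *: h k + h' k) x = a *: mext h x + mext h' x.
Proof.
rewrite /mext scaler_sumr -big_split; apply: eq_bigr => k _ /=.
by rewrite scalerDr !scalerA mulrC.
Qed.

Lemma eq_mext h h' : h =1 h' -> mext h =1 mext h'.
Proof. by move=> hh x; apply: eq_bigr => k _; rewrite hh. Qed.

Lemma malg_ext (f g : {malg K[T]} -> W) : linear f -> linear g ->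
  (forall k, f << k >> = g << k >>) -> f =1 g.
Proof.
move=> fL gL fg x; rewrite -[f]/(mklin fL : _ -> _) -[g]/(mklin gL : _ -> _).
rewrite (monalgE x) !linear_sum; apply: eq_bigr => k _.
have -> : << x@_k *g k >> = x@_k *: << k >> :> {malg K[T]}.
  by apply/malgP => l; rewrite mcoeffZ !mcoeffU mulrnAr mulr1.
by rewrite !linearZ /= fg.
Qed.

End Ext.

End FreeModule.

Section QuotientModule.
Variables (K : comNzRingType) (V : lmodType K) (S : V -> Prop).

Inductive submod_gen : V -> Prop :=
| SubmodGen0 : submod_gen 0
| SubmodGenD c x y : S x -> submod_gen y -> submod_gen (c *: x + y).

Definition submod_genb : {pred V} := [pred x | `[< submod_gen x >]].

Lemma submod_genZ c x : submod_gen x -> submod_gen (c *: x).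
Proof.
elim=> [|d y z Sy _ ih]; first by rewrite scaler0; exact: SubmodGen0.
by rewrite scalerDr scalerA; exact: SubmodGenD.
Qed.

Lemma submod_genD x y : submod_gen x -> submod_gen y -> submod_gen (x + y).
Proof.
by move=> + gy; elim=> [|d u v Su _ ih]; rewrite ?add0r // -addrA; exact: SubmodGenD.
Qed.

Fact submod_genb_zmod : zmod_closed submod_genb.
Proof.
split=> [|x y /asboolP gx /asboolP gy]; apply/asboolP; first exact: SubmodGen0.
by apply: submod_genD => //; rewrite -scaleN1r; exact: submod_genZ.
Qed.
HB.instance Definition _ := GRing.isZmodClosed.Build V submod_genb submod_genb_zmod.

Definition modquot : Type := Quotient.quot submod_genb.
HB.instance Definition _ := GRing.Zmodule.on modquot.
HB.instance Definition _ := EqQuotient.on modquot.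

Definition mqpi (x : V) : modquot := \pi_modquot x.

Lemma mqpiP x y : mqpi x = mqpi y <-> submod_gen (x - y).
Proof.
split=> [/eqP|h]; last by apply/eqP; rewrite /mqpi eqmodE; apply/asboolP.
by rewrite /mqpi eqmodE => /asboolP.
Qed.

Lemma mqpiK (x : modquot) : mqpi (repr x) = x. Proof. exact: reprK. Qed.

Lemma mqpiD x y : mqpi (x + y) = mqpi x + mqpi y.
Proof. exact: (pi_addr). Qed.

Lemma mqpi_rel x y : S (x - y) -> mqpi x = mqpi y.
Proof.
move=> Sxy; apply/mqpiP; rewrite -[_ - _]addr0 -[_ - _]scale1r.
exact/SubmodGenD/SubmodGen0.
Qed.

Definition mqscale (c : K) (x : modquot) : modquot := mqpi (c *: repr x).

Lemma mqscaleE c x : mqscale c (mqpi x) = mqpi (c *: x).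
Proof.
by apply/mqpiP; rewrite -scalerBr; apply/submod_genZ/mqpiP; rewrite mqpiK.
Qed.

Fact mqscaleA a b x : mqscale a (mqscale b x) = mqscale (a * b) x.
Proof. by rewrite -(mqpiK x) !mqscaleE scalerA. Qed.
Fact mqscale1 : left_id 1 mqscale.
Proof. by move=> x; rewrite -(mqpiK x) !mqscaleE scale1r. Qed.
Fact mqscaleDr : right_distributive mqscale +%R.
Proof.
move=> a x y; rewrite -(mqpiK x) -(mqpiK y) -mqpiD !mqscaleE.
by rewrite scalerDr mqpiD.
Qed.
Fact mqscaleDl x : {morph mqscale^~ x : a b / a + b}.
Proof. by move=> a b; rewrite -(mqpiK x) !mqscaleE scalerDl mqpiD. Qed.

HB.instance Definition _ := GRing.Zmodule_isLmodule.Build K modquot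
  mqscaleA mqscale1 mqscaleDr mqscaleDl.

Lemma mqpi_linear : linear mqpi.
Proof. by move=> a x y; rewrite mqpiD -mqscaleE. Qed.
HB.instance Definition _ := GRing.isLinear.Build K V modquot *:%R mqpi mqpi_linear.

Section Lift.
Variables (W : lmodType K) (f : {linear V -> W}).

Definition mqlift (x : modquot) : W := f (repr x).

Hypothesis fS : forall x, S x -> f x = 0.

Lemma mqliftE x : mqlift (mqpi x) = f x.
Proof.
apply/eqP; rewrite -subr_eq0 -linearB; apply/eqP.
have : submod_gen (repr (mqpi x) - x) by apply/mqpiP; rewrite mqpiK.
by elim=> [|c y z Sy _ ih]; rewrite ?linear0 // linearP ih fS // addr0 scaler0.
Qed.

Lemma mqlift_linear : linear mqlift.
Proof.
move=> a x y; rewrite -(mqpiK x) -(mqpiK y) -linearZ -linearD.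
by rewrite !mqliftE linearD linearZ.
Qed.
End Lift.

End QuotientModule.

Section BalancedTensor.
Variables (K : comNzRingType) (A : Type) (M N : lmodType K).
Variables (ra : M -> A -> M) (la : A -> N -> N).

(* For a K-algebra A acting K-linearly on the right of M by [ra] and on the left
   of N by [la], [balanced_tensor] is M (x)_A N with its K-module structure. *)
Inductive balanced_rel : {malg K[(M * N)%type]} -> Prop :=
| BalancedDl m m' n :
    balanced_rel (<< (m + m', n) >> - << (m, n) >> - << (m', n) >>)
| BalancedDr m n n' :
    balanced_rel (<< (m, n + n') >> - << (m, n) >> - << (m, n') >>)
| BalancedZl c m n : balanced_rel (<< (c *: m, n) >> - c *: << (m, n) >>)
| BalancedZr c m n : balanced_rel (<< (m, c *: n) >> - c *: << (m, n) >>)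
| BalancedA m a n : balanced_rel (<< (ra m a, n) >> - << (m, la a n) >>).

Definition balanced_tensor : Type := modquot balanced_rel.
HB.instance Definition _ := GRing.Lmodule.on balanced_tensor.

Definition tens (m : M) (n : N) : balanced_tensor :=
  mqpi balanced_rel << (m, n) >>.

Lemma tensDl m m' n : tens (m + m') n = tens m n + tens m' n.
Proof.
rewrite /tens -[RHS]mqpiD; apply: mqpi_rel.
by rewrite opprD addrA; exact: BalancedDl.
Qed.
Lemma tensDr m n n' : tens m (n + n') = tens m n + tens m n'.
Proof.
rewrite /tens -[RHS]mqpiD; apply: mqpi_rel.
by rewrite opprD addrA; exact: BalancedDr.
Qed.
Lemma tensZl c m n : tens (c *: m) n = c *: tens m n.
Proof. by rewrite -[RHS]linearZ; apply: mqpi_rel; exact: BalancedZl. Qed.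
Lemma tensZr c m n : tens m (c *: n) = c *: tens m n.
Proof. by rewrite -[RHS]linearZ; apply: mqpi_rel; exact: BalancedZr. Qed.
Lemma tensA m a n : tens (ra m a) n = tens m (la a n).
Proof. by apply: mqpi_rel; exact: BalancedA. Qed.

Section Lift.
Variables (W : lmodType K) (h : M -> N -> W).
Hypotheses (hl : forall n, linear (h^~ n)) (hr : forall m, linear (h m)).
Hypothesis hA : forall m a n, h (ra m a) n = h m (la a n).

Definition bt_lift : balanced_tensor -> W :=
  mqlift (mext (fun p : M * N => h p.1 p.2)).

Let hE m n : mext (fun p : M * N => h p.1 p.2) << (m, n) >> = h m n.
Proof. exact: mextU1. Qed.

Let hS x : balanced_rel x -> mext (fun p : M * N => h p.1 p.2) x = 0.
Proof.
have hDl m m' n : h (m + m') n = h m n + h m' n.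
  by have := hl n 1 m m'; rewrite !scale1r.
have hDr m n n' : h m (n + n') = h m n + h m n'.
  by have := hr m 1 n n'; rewrite !scale1r.
have h0l n : h 0 n = 0 by apply: (addrI (h 0 n)); rewrite -hDl !addr0.
have h0r m : h m 0 = 0 by apply: (addrI (h m 0)); rewrite -hDr !addr0.
case=> [m m' n|m n n'|c m n|c m n|m a n];
  rewrite !linearB /= ?linearZ /= !hE ?hDl ?hDr ?hA ?subrr //.
- by rewrite -addrA -opprD subrr.
- by rewrite -addrA -opprD subrr.
- by have := hl n c m 0; rewrite addr0 h0l addr0 => ->; rewrite scalerN subrr.
- by have := hr m c n 0; rewrite addr0 h0r addr0 => ->; rewrite scalerN subrr.
Qed.

Lemma bt_lift_linear : linear bt_lift.
Proof. exact: mqlift_linear. Qed.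

Lemma bt_lift_tens m n : bt_lift (tens m n) = h m n.
Proof. by rewrite /bt_lift mqliftE //= hE. Qed.
End Lift.

Lemma bt_ext (W : lmodType K) (f g : {linear balanced_tensor -> W}) :
  (forall m n, f (tens m n) = g (tens m n)) -> f =1 g.
Proof.
move=> fg x; rewrite -(mqpiK x).
apply: (malg_ext (f := f \o mqpi _) (g := g \o mqpi _)) => [||[m n]]; last exact: fg.
- exact: linearP.
- exact: linearP.
Qed.

End BalancedTensor.

Arguments tens {K A M N} ra la m n.

Section TensorMap.
Variables (K : comNzRingType) (A A' : Type) (M N M' N' : lmodType K).
Variables (ra : M -> A -> M) (la : A -> N -> N).
Variables (ra' : M' -> A' -> M') (la' : A' -> N' -> N').
Variables (f : {linear M -> M'}) (h : {linear N -> N'}).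

Definition tensor_compat : Prop := exists phi : A -> A',
  (forall m a, f (ra m a) = ra' (f m) (phi a)) /\
  (forall a n, h (la a n) = la' (phi a) (h n)).

Hypothesis fh : tensor_compat.

Let th m n : balanced_tensor ra' la' := tens ra' la' (f m) (h n).

Lemma tensor_map_linear : linear (bt_lift th : balanced_tensor ra la -> _).
Proof.
case: fh => phi [fA hA]; apply: bt_lift_linear => [n c m m'|m c n n'|m a n].
- by rewrite /th linearP tensDl tensZl.
- by rewrite /th linearP tensDr tensZr.
- by rewrite /th fA tensA -hA.
Qed.

Definition tensor_map : {linear balanced_tensor ra la -> balanced_tensor ra' la'} :=
  mklin tensor_map_linear.

Lemma tensor_mapE m n :
  tensor_map (tens ra la m n) = tens ra' la' (f m) (h n).
Proof.
case: fh => phi [fA hA]; apply: bt_lift_tens => [{}n c {}m m'|{}m c {}n n'|{}m a {}n].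
- by rewrite /th linearP tensDl tensZl.
- by rewrite /th linearP tensDr tensZr.
- by rewrite /th fA tensA -hA.
Qed.

End TensorMap.

Arguments tensor_map : simpl never.

Section Tensor.
Variables (K : comNzRingType) (M N : lmodType K).
Definition scale_right (m : M) (a : K) : M := a *: m.
Definition scale_left (a : K) (n : N) : N := a *: n.
Definition tensor : lmodType K := balanced_tensor scale_right scale_left.
Definition tensK (m : M) (n : N) : tensor := tens scale_right scale_left m n.
End Tensor.

Lemma tensor_compatK (K : comNzRingType) (M N M' N' : lmodType K)
    (f : {linear M -> M'}) (h : {linear N -> N'}) :
  tensor_compat (@scale_right K M) (@scale_left K N)
    (@scale_right K M') (@scale_left K N') f h.
Proof. by exists id; split=> *; rewrite /scale_right /scale_left linearZ. Qed.

Section GroupRing.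
Variables (K : comNzRingType) (G : groupType).

Definition group_ring : Type := {malg K[G]}.
HB.instance Definition _ := GRing.Lmodule.on group_ring.
Implicit Types x y z : group_ring.

Definition grmul x y : group_ring :=
  mext (fun g => mext (fun h => << (g * h)%g >>) y : group_ring) x.

Lemma grmulUU g h : grmul << g >> << h >> = << (g * h)%g >>.
Proof. by rewrite /grmul !mextU1. Qed.

Lemma grmul_linear_l y : linear (grmul^~ y).
Proof. exact: mext_linear. Qed.

Lemma grmul_linear_r x : linear (grmul x).
Proof.
move=> a y z; rewrite /grmul -mextZD; apply: eq_mext => g; exact: mext_linear.
Qed.

Lemma linear_comp (U V W : lmodType K) (f : V -> W) (g : U -> V) :
  linear f -> linear g -> linear (f \o g).
Proof. by move=> fL gL a x y /=; rewrite gL fL. Qed.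

Fact grmulA : associative grmul.
Proof.
move=> x y z; move: x.
apply: malg_ext => [||g]; first exact: grmul_linear_l.
  exact: (linear_comp (grmul_linear_l z) (grmul_linear_l y)).
move: y; apply: malg_ext => [||h].
- exact: (linear_comp (grmul_linear_r _) (grmul_linear_l z)).
- exact: (linear_comp (grmul_linear_l z) (grmul_linear_r _)).
move: z; apply: malg_ext => [||k].
- exact: (linear_comp (grmul_linear_r _) (grmul_linear_r _)).
- exact: grmul_linear_r.
by rewrite !grmulUU mulgA.
Qed.

Fact grmul1 : left_id (<< 1%g >> : group_ring) grmul.
Proof.
apply: malg_ext => [||g]; [exact: grmul_linear_r | by move=> ? ? ? |].
by rewrite grmulUU mul1g.
Qed.

Fact grmulr1 : right_id (<< 1%g >> : group_ring) grmul.
Proof.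
apply: malg_ext => [||g]; [exact: grmul_linear_l | by move=> ? ? ? |].
by rewrite grmulUU mulg1.
Qed.

Fact grmulDl : left_distributive grmul +%R.
Proof. by move=> x y z; have := grmul_linear_l z 1 x y; rewrite !scale1r. Qed.
Fact grmulDr : right_distributive grmul +%R.
Proof. by move=> x y z; have := grmul_linear_r x 1 y z; rewrite !scale1r. Qed.
Fact gr1_neq0 : (<< 1%g >> : group_ring) != 0.
Proof. by rewrite monalgU_eq0 oner_eq0. Qed.

HB.instance Definition _ := GRing.Zmodule_isNzRing.Build group_ring
  grmulA grmul1 grmulr1 grmulDl grmulDr gr1_neq0.

Definition gr_of (g : G) : group_ring := << g >>.

Lemma gr_mulE (g h : G) : gr_of g * gr_of h = gr_of (g * h)%g.
Proof. exact: grmulUU. Qed.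
Lemma gr_1E : gr_of 1%g = 1. Proof. by []. Qed.
Lemma gr_ofE g : gr_of g = << g >>. Proof. by []. Qed.

Lemma gr_mul_linear_l y : linear ( *%R^~ y : group_ring -> group_ring).
Proof. exact: grmul_linear_l. Qed.
Lemma gr_mul_linear_r x : linear ( *%R x : group_ring -> group_ring).
Proof. exact: grmul_linear_r. Qed.

Lemma gr_ext (W : lmodType K) (f g : group_ring -> W) :
  linear f -> linear g -> (forall k, f (gr_of k) = g (gr_of k)) -> f =1 g.
Proof. exact: malg_ext. Qed.

Definition gr_aug (x : group_ring) : K^o := mext (fun _ : G => 1 : K^o) x.

Lemma gr_aug_linear : linear gr_aug. Proof. exact: mext_linear. Qed.
HB.instance Definition _ :=
  GRing.isLinear.Build K group_ring K^o *:%R gr_aug gr_aug_linear.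

Lemma gr_augU g : gr_aug (gr_of g) = 1. Proof. exact: mextU1. Qed.

Lemma gr_augM x y : gr_aug (x * y) = gr_aug x * gr_aug y.
Proof.
move: x; apply: gr_ext => [||g].
- exact: (linear_comp gr_aug_linear (gr_mul_linear_l y)).
- by move=> a x x'; rewrite linearP mulrDl scalerAl.
move: y; apply: gr_ext => [||h].
- exact: (linear_comp gr_aug_linear (gr_mul_linear_r _)).
- by move=> a x x'; rewrite linearP mulrDr scalerAr.
by rewrite gr_mulE !gr_augU mul1r.
Qed.

Definition aug_pred : {pred group_ring} := [pred x | gr_aug x == 0].

Fact aug_submod : submod_closed aug_pred.
Proof.
split=> [|a x y /eqP ax /eqP ay]; first by rewrite inE linear0.
by rewrite inE linearP /= ax ay scaler0 addr0.
Qed.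
HB.instance Definition _ := GRing.isSubmodClosed.Build K group_ring aug_pred aug_submod.

Record aug_ideal : Type := AugIdeal { aug_val : group_ring; _ : aug_val \in aug_pred }.
HB.instance Definition _ := [isSub for aug_val].
HB.instance Definition _ := [Choice of aug_ideal by <:].
HB.instance Definition _ := [SubChoice_isSubLmodule of aug_ideal by <:].

Lemma aug_valP (x : aug_ideal) : gr_aug (aug_val x) = 0.
Proof. by apply/eqP; case: x. Qed.

Fact aug_mul_subproof (x : aug_ideal) (a : group_ring) :
  aug_val x * a \in aug_pred.
Proof. by rewrite inE gr_augM aug_valP mul0r. Qed.

Definition aug_mul (x : aug_ideal) (a : group_ring) : aug_ideal :=
  AugIdeal (aug_mul_subproof x a).

Fact aug_gen_subproof (g : G) : gr_of g - 1 \in aug_pred.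
Proof. by rewrite inE linearB /= -gr_1E !gr_augU subrr. Qed.

Definition aug_gen (g : G) : aug_ideal := AugIdeal (aug_gen_subproof g).

End GroupRing.

Section GroupRingMap.
Variables (K : comNzRingType) (G H : groupType) (phi : {multiplicative G -> H}).

Definition gr_map : group_ring K G -> group_ring K H :=
  mext (fun g => gr_of K (phi g)).

Lemma gr_map_linear : linear gr_map. Proof. exact: mext_linear. Qed.
HB.instance Definition _ := GRing.isLinear.Build K (group_ring K G)
  (group_ring K H) *:%R gr_map gr_map_linear.

Lemma gr_mapU g : gr_map (gr_of K g) = gr_of K (phi g).
Proof. exact: mextU1. Qed.

Lemma gr_mapM x y : gr_map (x * y) = gr_map x * gr_map y.
Proof.
move: x; apply: gr_ext => [||g].
- exact: (linear_comp gr_map_linear (gr_mul_linear_l y)).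
- exact: (linear_comp (gr_mul_linear_l _) gr_map_linear).
move: y; apply: gr_ext => [||h].
- exact: (linear_comp gr_map_linear (gr_mul_linear_r _)).
- exact: (linear_comp (gr_mul_linear_r _) gr_map_linear).
by rewrite gr_mulE !gr_mapU gr_mulE multM.
Qed.

Lemma gr_map_aug x : gr_aug (gr_map x) = gr_aug x.
Proof.
move: x; apply: gr_ext => [||g]; last by rewrite gr_mapU !gr_augU.
  exact: (linear_comp (@gr_aug_linear _ _) gr_map_linear).
exact: gr_aug_linear.
Qed.

Fact aug_map_subproof (x : aug_ideal K G) : gr_map (aug_val x) \in @aug_pred K H.
Proof. by rewrite inE gr_map_aug aug_valP. Qed.

Definition aug_map_fun (x : aug_ideal K G) : aug_ideal K H :=
  AugIdeal (aug_map_subproof x).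

Fact aug_map_linear : linear aug_map_fun.
Proof. by move=> a x y; apply: val_inj; rewrite /= gr_map_linear. Qed.

Definition aug_map : {linear aug_ideal K G -> aug_ideal K H} :=
  mklin aug_map_linear.

Lemma aug_map_mul x a : aug_map (aug_mul x a) = aug_mul (aug_map x) (gr_map a).
Proof. by apply: val_inj; rewrite /= gr_mapM. Qed.

End GroupRingMap.

Lemma gr_map_id (K : comNzRingType) (G : groupType)
    (phi : {multiplicative G -> G}) : phi =1 id -> gr_map (K := K) phi =1 id.
Proof.
move=> e; apply: gr_ext => [||g]; [exact: gr_map_linear | by move=> ? ? ? |].
by rewrite gr_mapU e.
Qed.

Lemma gr_map_comp (K : comNzRingType) (G H I : groupType)
    (psi : {multiplicative H -> I}) (phi : {multiplicative G -> H})
    (chi : {multiplicative G -> I}) : chi =1 psi \o phi ->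
  gr_map (K := K) chi =1 gr_map psi \o gr_map phi.
Proof.
move=> e; apply: gr_ext => [||g]; first exact: gr_map_linear.
  exact: (linear_comp (gr_map_linear _) (gr_map_linear _)).
by rewrite /= !gr_mapU e.
Qed.

Section Laurent.
Variable C : comNzRingType.

(* C[t, t^-1] as the group ring over C of the infinite cyclic group. *)
Definition laurent : Type := group_ring C (Algebra.to_multiplicative int).
HB.instance Definition _ := GRing.NzRing.on laurent.
HB.instance Definition _ := GRing.Lmodule.on laurent.

Fact laurent_mulC : commutative (@GRing.mul laurent).
Proof.
move=> x y; move: x; apply: (@gr_ext C (Algebra.to_multiplicative int)) => [||i].
- exact: gr_mul_linear_l.
- exact: gr_mul_linear_r.
move: y; apply: (@gr_ext C (Algebra.to_multiplicative int)) => [||j].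
- exact: gr_mul_linear_r.
- exact: gr_mul_linear_l.
by rewrite !gr_mulE; congr gr_of; exact: addrC.
Qed.
HB.instance Definition _ :=
  GRing.PzRing_hasCommutativeMul.Build laurent laurent_mulC.

Definition laurent_unit : {pred laurent} := [pred x | `[< exists y, y * x = 1 >]].
Definition laurent_inv (x : laurent) : laurent :=
  if pselect (exists y, y * x = 1) is left h then projT1 (cid h) else x.

Fact laurent_mulVr : {in laurent_unit, left_inverse 1 laurent_inv *%R}.
Proof.
move=> x /asboolP ux; rewrite /laurent_inv; case: pselect => // h.
exact: projT2 (cid h).
Qed.
Fact laurent_unitP (x y : laurent) : y * x = 1 -> x \in laurent_unit.
Proof. by move=> yx; apply/asboolP; exists y. Qed.
Fact laurent_inv_out : {in [predC laurent_unit], laurent_inv =1 id}.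
Proof.
move=> x; rewrite inE => /asboolPn nux; rewrite /laurent_inv.
by case: pselect.
Qed.
HB.instance Definition _ := GRing.ComNzRing_hasMulInverse.Build laurent
  laurent_mulVr laurent_unitP laurent_inv_out.

Definition laurentX : laurent := gr_of C (1%R : Algebra.to_multiplicative int).

Lemma laurentX_unit : laurentX \is a GRing.unit.
Proof.
apply/unitrP; exists (gr_of C (-1 : Algebra.to_multiplicative int) : laurent); split;
  rewrite [LHS]gr_mulE -gr_1E; congr gr_of.
Qed.

Lemma laurentXV_unit : laurentX^-1 \is a GRing.unit.
Proof. by rewrite unitrV laurentX_unit. Qed.

Lemma laurentX2_unit : laurentX ^+ 2 \is a GRing.unit.
Proof. exact/unitrX/laurentX_unit. Qed.

End Laurent.

Record category := Category {
  obj :> Type;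
  hom : obj -> obj -> Type;
  idc : forall x, hom x x;
  compc : forall x y z, hom y z -> hom x y -> hom x z;
  compc1 : forall x y (f : hom x y), compc f (idc x) = f;
  comp1c : forall x y (f : hom x y), compc (idc y) f = f;
  compcA : forall x y z t (h : hom z t) (g : hom y z) (f : hom x y),
    compc h (compc g f) = compc (compc h g) f }.
Arguments idc {c} x.
Arguments compc {c x y z}.

Definition is_iso (C : category) (x y : C) (f : hom x y) : Prop :=
  exists g : hom y x, compc g f = idc x /\ compc f g = idc y.

Record functor (C D : category) := Functor {
  fobj :> C -> D;
  fmap : forall x y : C, hom x y -> hom (fobj x) (fobj y);
  fmap1 : forall x, fmap (idc x) = idc (fobj x);
  fmapM : forall x y z (g : hom y z) (f : hom x y),
    fmap (compc g f) = compc (fmap g) (fmap f) }.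
Arguments fmap {C D} f0 {x y}.

Record nat_trans (C D : category) (F G : functor C D) := NatTrans {
  nat_app :> forall x, hom (F x) (G x);
  natural : forall x y (f : hom x y),
    compc (fmap G f) (nat_app x) = compc (nat_app y) (fmap F f) }.

Section FunctorCategory.
Variables C D : category.

Lemma nat_trans_eq (F G : functor C D) (a b : nat_trans F G) :
  (forall x, a x = b x) -> a = b.
Proof.
case: a b => [a na] [b nb] /= ab; have {}ab : a = b by apply: functional_extensionality_dep.
by case: _ / ab nb => nb; rewrite (Prop_irrelevance na nb).
Qed.

Fact nat_id_subproof (F : functor C D) x y (f : hom x y) :
  compc (fmap F f) (idc (F x)) = compc (idc (F y)) (fmap F f).
Proof. by rewrite compc1 comp1c. Qed.
Definition nat_id (F : functor C D) : nat_trans F F :=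
  NatTrans (@nat_id_subproof F).

Fact nat_comp_subproof (F G H : functor C D) (b : nat_trans G H)
    (a : nat_trans F G) x y (f : hom x y) :
  compc (fmap H f) (compc (b x) (a x)) = compc (compc (b y) (a y)) (fmap F f).
Proof. by rewrite compcA natural -compcA natural compcA. Qed.
Definition nat_comp (F G H : functor C D) (b : nat_trans G H)
    (a : nat_trans F G) : nat_trans F H := NatTrans (nat_comp_subproof b a).

Definition Fct : category.
Proof.
refine (@Category (functor C D) (@nat_trans C D) nat_id nat_comp _ _ _).
- by move=> F G a; apply: nat_trans_eq => x; apply: compc1.
- by move=> F G a; apply: nat_trans_eq => x; apply: comp1c.
- by move=> F G H I c b a; apply: nat_trans_eq => x; apply: compcA.
Defined.

End FunctorCategory.

Definition lin_id (K : pzRingType) (M : lmodType K) : {linear M -> M} := idfun.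
Definition lin_comp (K : pzRingType) (M N P : lmodType K)
  (g : {linear N -> P}) (f : {linear M -> N}) : {linear M -> P} := g \o f.

Definition Mod (K : pzRingType) : category.
Proof.
by refine (@Category (lmodType K) (fun M N => {linear M -> N}) (@lin_id K)
  (@lin_comp K) _ _ _) => *; apply: linear_eq.
Defined.

Section Grp.
Lemma multiplicative_eq (G H : groupType) (f g : {multiplicative G -> H}) :
  f =1 g -> f = g.
Proof.
case: f g => [f [[fa]]] [g [[ga]]] /= /funext fg.
by case: _ / fg ga => ga; rewrite (Prop_irrelevance fa ga).
Qed.

Definition mult_id (G : groupType) : {multiplicative G -> G} := idfun.
Definition mult_comp (G H I : groupType) (g : {multiplicative H -> I})
  (f : {multiplicative G -> H}) : {multiplicative G -> I} := g \o f.

Definition Grp : category.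
Proof.
by refine (@Category groupType (fun G H => {multiplicative G -> H}) mult_id
  mult_comp _ _ _) => *; apply: multiplicative_eq.
Defined.
End Grp.

(* [beta_comp (Beta t) (Beta s)] is [Beta (t * s)]: products in braid groups are
   read from right to left. *)
Inductive beta_hom : nat -> nat -> Type :=
| Beta (n : nat) (s : 'B^n) : beta_hom n n.

Definition beta_id (n : nat) : beta_hom n n := Beta (1%g : 'B^n).

Definition beta_comp (m n p : nat) (g : beta_hom n p) (f : beta_hom m n) :
    beta_hom m p :=
  match g in beta_hom n p return beta_hom m n -> beta_hom m p with
  | @Beta n t => fun f : beta_hom m n =>
      match f in beta_hom m n return 'B^n -> beta_hom m n with
      | @Beta n s => fun t => Beta (t * s)%g
      end t
  end f.

Definition beta : category.
Proof.
refine (@Category nat beta_hom beta_id beta_comp _ _ _).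
- by move=> m n [k s]; rewrite /= mulg1.
- by move=> m n [k s]; rewrite /= mul1g.
- move=> m n p q h g; case: h g => [k u] g; case: g u => {p k} [k t] u f.
  by case: f t u => {m n} [k' s] t u /=; rewrite mulgA.
Defined.

Section BraidFunctor.
Variables (C : category) (x : nat -> C).
Variables (s s' : forall n, 'I_n.-1 -> hom (x n) (x n)).

Record braid_datum : Prop := BraidDatum {
  bd_inv : forall n (i : 'I_n.-1), compc (s i) (s' i) = idc (x n);
  bd_vni : forall n (i : 'I_n.-1), compc (s' i) (s i) = idc (x n);
  bd_rel : forall n (i j : 'I_n.-1), j = i.+1 :> nat ->
    compc (s i) (compc (s j) (s i)) = compc (s j) (compc (s i) (s j));
  bd_comm : forall n (i j : 'I_n.-1), (i.+1 < j)%N ->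
    compc (s i) (s j) = compc (s j) (s i) }.

Hypothesis d : braid_datum.

Definition braid_val n (l : letter 'I_n.-1) : hom (x n) (x n) :=
  if l.2 then s' l.1 else s l.1.

Definition braid_act n (t : 'B^n) : hom (x n) (x n) :=
  weval compc (idc (x n)) (@braid_val n) (repr t).

Let bV n l : compc (@braid_val n l) (@braid_val n (linv l)) = idc (x n).
Proof. by case: l => i [] /=; rewrite /braid_val /= (bd_inv d, bd_vni d). Qed.

Let bR n u v : @braid_rel n u v ->
  weval compc (idc (x n)) (@braid_val n) u = weval compc (idc (x n)) (@braid_val n) v.
Proof.
by case=> i j ij; rewrite /= /braid_val /= !compc1; [apply: bd_rel|apply: bd_comm].
Qed.

Lemma braid_act1 n : @braid_act n 1%g = idc (x n).
Proof.
by apply: weval_one; [exact: compcA|exact: comp1c|exact: compc1|exact: bV|exact: bR].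
Qed.

Lemma braid_actM n (t u : 'B^n) :
  braid_act (t * u)%g = compc (braid_act t) (braid_act u).
Proof.
by apply: weval_mul; [exact: compcA|exact: comp1c|exact: compc1|exact: bV|exact: bR].
Qed.

Lemma braid_act_gen n (i : 'I_n.-1) : braid_act (sigma i) = s i.
Proof.
by apply: weval_gen; [exact: compcA|exact: comp1c|exact: compc1|exact: bV|exact: bR].
Qed.

Definition braid_fmap m n (f : beta_hom m n) : hom (x m) (x n) :=
  match f in beta_hom m n return hom (x m) (x n) with
  | @Beta n t => braid_act t
  end.

Definition braid_functor : functor beta C.
Proof.
refine (@Functor beta C x braid_fmap _ _); first exact: braid_act1.
move=> m n p g f; case: g f => {p}n t f; case: f t => {m n} n u t.
exact: braid_actM.
Defined.

End BraidFunctor.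

Lemma braid_ind n (P : 'B^n -> Prop) :
  (forall i, P (sigma i)) -> P 1%g ->
  (forall s t, P s -> P t -> P (s * t)%g) -> (forall s, P s -> P s^-1%g) ->
  forall s, P s.
Proof. move=> Pg P1 PM PV; apply: pres_ind => // i s Ps; apply: PM => //; first exact: Pg.
exact/PV/Pg. Qed.

Section ArtinRelations.
Variable n : nat.
Implicit Types i j : 'I_n.-1.

Lemma artin_genE i k : artin_gen i (fgen k) = artin_gen_val i k.
Proof. exact: free_lift_gen. Qed.
Lemma artin_gen_invE i k : artin_gen_inv i (fgen k) = artin_gen_inv_val i k.
Proof. exact: free_lift_gen. Qed.
Lemma artin_lo i : artin_gen i (fgen (lo i)) = fgen (hi i).
Proof. by rewrite artin_genE /artin_gen_val eqxx. Qed.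
Lemma artin_hi i : artin_gen i (fgen (hi i)) =
  ((fgen (hi i))^-1 * fgen (lo i) * fgen (hi i))%g.
Proof. by rewrite artin_genE /artin_gen_val hi_lo eqxx. Qed.
Lemma artin_other i k : k != lo i -> k != hi i -> artin_gen i (fgen k) = fgen k.
Proof. by rewrite artin_genE /artin_gen_val => /negbTE-> /negbTE->. Qed.
Lemma artin_inv_lo i : artin_gen_inv i (fgen (lo i)) =
  (fgen (lo i) * fgen (hi i) * (fgen (lo i))^-1)%g.
Proof. by rewrite artin_gen_invE /artin_gen_inv_val eqxx. Qed.
Lemma artin_inv_hi i : artin_gen_inv i (fgen (hi i)) = fgen (lo i).
Proof. by rewrite artin_gen_invE /artin_gen_inv_val hi_lo eqxx. Qed.
Lemma artin_inv_other i k : k != lo i -> k != hi i ->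
  artin_gen_inv i (fgen k) = fgen k.
Proof. by rewrite artin_gen_invE /artin_gen_inv_val => /negbTE-> /negbTE->. Qed.

Lemma artin_genK i : artin_gen i \o artin_gen_inv i =1 id.
Proof.
apply: (free_ext (g := mult_id _)) => k /=; rewrite -/(fgen k).
have [->|kl] := eqVneq k (lo i).
  by rewrite artin_inv_lo !multM multV artin_lo artin_hi !mulgA mulgV mul1g mulgK.
have [->|kh] := eqVneq k (hi i); first by rewrite artin_inv_hi artin_lo.
by rewrite artin_inv_other // artin_other.
Qed.

Lemma artin_gen_invK i : artin_gen_inv i \o artin_gen i =1 id.
Proof.
apply: (free_ext (g := mult_id _)) => k /=; rewrite -/(fgen k).
have [->|kl] := eqVneq k (lo i); first by rewrite artin_lo artin_inv_hi.
have [->|kh] := eqVneq k (hi i); last by rewrite artin_other // artin_inv_other.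
by rewrite artin_hi !multM multV artin_inv_hi artin_inv_lo !mulgA mulVg mul1g mulgVK.
Qed.

Lemma artin_gen_rel i j : j = i.+1 :> nat ->
  artin_gen i \o (artin_gen j \o artin_gen i) =1
  artin_gen j \o (artin_gen i \o artin_gen j).
Proof.
move=> ij; have ljhi : lo j = hi i by apply: val_inj.
have hjli : hi j != lo i by rewrite -val_eqE /= ij gtn_eqF // ltnW.
have hjhi : hi j != hi i by rewrite -val_eqE /= ij gtn_eqF.
have lilj : lo i != lo j by rewrite ljhi lo_hi.
have lihj : lo i != hi j by rewrite eq_sym.
pose E := (artin_lo i, artin_hi i, artin_other hjli hjhi).
have Ej1 := artin_lo j; have Ej2 := artin_hi j; rewrite ljhi in Ej1 Ej2 lilj.
have Ej3 := artin_other (i := j) (k := lo i); rewrite ljhi in Ej3.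
have {}Ej3 := Ej3 lilj lihj.
apply: free_ext => k /=; rewrite -/(fgen k).
have [->|kl] := eqVneq k (lo i); first by rewrite !(E, Ej1, Ej2, Ej3).
have [->|kh] := eqVneq k (hi i).
  by rewrite !(E, Ej1, Ej2, Ej3, multM, multV).
have [->|kj] := eqVneq k (hi j); last first.
  have kj' : k != lo j by rewrite ljhi.
  by rewrite !(artin_other kl kh, artin_other kj' kj).
rewrite !(E, Ej1, Ej2, Ej3, multM, multV) !invgM !invgK !mulgA.
by rewrite !mulgK.
Qed.

Lemma artin_gen_comm i j : (i.+1 < j)%N ->
  artin_gen i \o artin_gen j =1 artin_gen j \o artin_gen i.
Proof.
move=> ij; have d : [/\ lo i != lo j, lo i != hi j, hi i != lo j & hi i != hi j].
  have ij' := ltnW ij.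
  by split; rewrite -val_eqE /= neq_ltn ?ij ?ij' ?ltnS ?ij' ?(ltnW ij') // ltnW.
case: d => d1 d2 d3 d4; have d5 := d1; have d6 := d2; have d7 := d3; have d8 := d4.
rewrite eq_sym in d5; rewrite eq_sym in d6; rewrite eq_sym in d7; rewrite eq_sym in d8.
pose E := (artin_lo i, artin_hi i, artin_lo j, artin_hi j, artin_other d1 d2,
  artin_other d3 d4, artin_other d5 d7, artin_other d6 d8).
apply: free_ext => k /=; rewrite -/(fgen k).
have [->|kl] := eqVneq k (lo i); first by rewrite !E.
have [->|kh] := eqVneq k (hi i); first by rewrite !(E, multM, multV).
have [->|kl'] := eqVneq k (lo j); first by rewrite !E.
have [->|kh'] := eqVneq k (hi j); first by rewrite !(E, multM, multV).
by rewrite !(artin_other kl kh, artin_other kl' kh').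
Qed.

End ArtinRelations.

Definition free_obj (n : nat) : Grp := 'F^n : groupType.

Fact artin_datum : @braid_datum Grp free_obj artin_gen artin_gen_inv.
Proof.
split=> n.
- by move=> i; apply/multiplicative_eq/artin_genK.
- by move=> i; apply/multiplicative_eq/artin_gen_invK.
- by move=> i j ij; apply/multiplicative_eq/artin_gen_rel.
- by move=> i j ij; apply/multiplicative_eq/artin_gen_comm.
Qed.

Definition artin : functor beta Grp := braid_functor artin_datum.

(* The functor [artin] maps n to F_n; on morphisms it is the Artin
   representation, with values in the automorphisms of F_n. *)
Definition artin_rep (n : nat) (s : 'B^n) : {multiplicative 'F^n -> 'F^n} :=
  fmap artin (Beta s).

Lemma artin_rep_gen n (i : 'I_n.-1) : artin_rep (sigma i) = artin_gen i.
Proof. exact: (braid_act_gen artin_datum i). Qed.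
Lemma artin_rep1 n : artin_rep (1%g : 'B^n) = mult_id _.
Proof. exact: (fmap1 artin n). Qed.
Lemma artin_repM n (s t : 'B^n) : artin_rep (s * t)%g = mult_comp (artin_rep s) (artin_rep t).
Proof. exact: (fmapM artin (Beta s) (Beta t)). Qed.

Lemma equivariance n (s : 'B^n) g :
  (varsigma n (artin_rep s g) * shift n s = shift n s * varsigma n g)%g.
Proof.
move: s g; apply: braid_ind => [i|||] g.
- by rewrite artin_rep_gen shift_gen equivariance_gen.
- by rewrite artin_rep1 mult1 mul1g mulg1.
- by move=> t ihs iht h; rewrite artin_repM multM mulgA ihs -mulgA iht mulgA.
- move=> ih h; rewrite multV; apply: (mulgI (shift n g)).
  rewrite mulgA -ih !mulgA mulgK mulgV mul1g.
  have := congr1 (fun f : {multiplicative 'F^n -> 'F^n} => f h) (artin_repM g g^-1%g).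
  by rewrite mulgV artin_rep1 /= => <-.
Qed.

Section TensorFunctor.
Variables (K : comNzRingType) (C : category) (F G : functor C (Mod K)).

Definition tensor_fobj (x : C) : Mod K := tensor (F x : lmodType K) (G x : lmodType K).
Definition tensor_fmap (x y : C) (f : hom x y) : hom (tensor_fobj x) (tensor_fobj y) :=
  tensor_map (tensor_compatK (fmap F f) (fmap G f)).

Definition tensor_functor : functor C (Mod K).
Proof.
refine (@Functor C (Mod K) tensor_fobj tensor_fmap _ _).
- move=> x; apply/linear_eq/bt_ext => m n.
  by rewrite [LHS]tensor_mapE !fmap1.
- move=> x y z g f; apply/linear_eq/bt_ext => m n.
  rewrite [LHS]tensor_mapE !fmapM; apply: esym.
  apply: etrans (congr1 (tensor_fmap g) (tensor_mapE _ _ _)) _.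
  exact: tensor_mapE.
Defined.

End TensorFunctor.

Section UnitFunctor.
Variables (K : comUnitRingType) (y : K) (yU : y \is a GRing.unit).

Definition scale_lin (c : K) : {linear K^o -> K^o} := *:%R c.
Fact unit_datum : @braid_datum (Mod K) (fun _ => K^o : lmodType K)
  (fun _ _ => scale_lin y) (fun _ _ => scale_lin y^-1).
Proof.
by split=> // n i; apply: linear_eq => v; rewrite /= scalerA ?(mulrV yU) ?(mulVr yU) scale1r.
Qed.

(* The functor y \mathfrak X. *)
Definition unit_functor : functor beta (Mod K) := braid_functor unit_datum.

Lemma unit_functor_gen n (i : 'I_n.-1) :
  fmap unit_functor (Beta (sigma i)) = scale_lin y.
Proof. exact: (braid_act_gen unit_datum i). Qed.

(* The functor y F = y \mathfrak X (x)_K F. *)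
Definition unit_twist (F : functor beta (Mod K)) : functor beta (Mod K) :=
  tensor_functor unit_functor F.

End UnitFunctor.

Section Burau.
Variable K : comUnitRingType.

(* Id (+) [a b; c d] (+) Id, the block lying in rows and columns lo i, hi i. *)
Definition block2 (n : nat) (i : 'I_n.-1) (a b c d : K) : 'M[K]_n :=
  \matrix_(j, k)
    if j == lo i then (if k == lo i then a else if k == hi i then b else 0)
    else if j == hi i then (if k == lo i then c else if k == hi i then d else 0)
    else (j == k)%:R.

Definition burau_mx (q : K) (n : nat) (i : 'I_n.-1) : 'M[K]_n :=
  block2 i 0 q 1 (1 - q).

Definition burau_inv_mx (q : K) (n : nat) (i : 'I_n.-1) : 'M[K]_n :=
  block2 i (1 - q^-1) 1 q^-1 0.

Definition mulmx_lin (n : nat) (A : 'M[K]_n) : {linear 'cV[K]_n -> 'cV[K]_n} :=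
  mulmx A.

Lemma block2E n (i : 'I_n.-1) a b c d (v : 'cV[K]_n) j :
  (block2 i a b c d *m v) j 0 =
    if j == lo i then a * v (lo i) 0 + b * v (hi i) 0
    else if j == hi i then c * v (lo i) 0 + d * v (hi i) 0
    else v j 0.
Proof.
have two (x y : K) : \sum_k (if k == lo i then x else if k == hi i then y else 0) * v k 0
    = x * v (lo i) 0 + y * v (hi i) 0.
  rewrite (bigD1 (lo i)) //= eqxx (bigD1 (hi i)) /= ?hi_lo // eqxx big1 ?addr0 //.
  by move=> k /andP[/negbTE-> /negbTE->]; rewrite mul0r.
rewrite mxE; under eq_bigr => k _ do rewrite mxE.
case: (j == lo i); first exact: two.
case: (j == hi i); first exact: two.
rewrite (bigD1 j) //= eqxx mul1r big1 ?addr0 // => k.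
by rewrite eq_sym => /negbTE->; rewrite mul0r.
Qed.

Variables (q : K) (qU : q \is a GRing.unit).

Definition col_obj (n : nat) : Mod K := 'cV[K]_n : lmodType K.

Fact burau_datum : @braid_datum (Mod K) col_obj
  (fun n i => mulmx_lin (burau_mx q i)) (fun n i => mulmx_lin (burau_inv_mx q i)).
Proof.
have qV := mulrV qU; split=> n.
- move=> i; apply: linear_eq => v; apply/matrixP => j z; rewrite (ord1 z) /=.
  rewrite !block2E eqxx hi_lo eqxx; case: eqP => [->|_].
    by ring: qV.
  case: eqP => [->|_] //; by ring: qV.
- move=> i; apply: linear_eq => v; apply/matrixP => j z; rewrite (ord1 z) /=.
  rewrite !block2E eqxx hi_lo eqxx; case: eqP => [->|_].
    by ring: qV.
  case: eqP => [->|_] //; by ring: qV.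
- move=> i j ij; have ljhi : lo j = hi i by apply: val_inj.
  have hjli : (hi j == lo i) = false by rewrite -val_eqE /= ij gtn_eqF // ltnW.
  have hjhi : (hi j == hi i) = false by rewrite -val_eqE /= ij gtn_eqF.
  have lihj : (lo i == hi j) = false by rewrite eq_sym.
  have hihj : (hi i == hi j) = false by rewrite eq_sym.
  apply: linear_eq => v; apply/matrixP => k z; rewrite (ord1 z) /=.
  rewrite !block2E !ljhi !(eqxx, hi_lo, lo_hi, hjli, hjhi, lihj, hihj).
  have [kE|kl] := eqVneq k (lo i); first by rewrite ?kE ?(lo_hi, lihj); ring.
  have [kE|kh] := eqVneq k (hi i); first by rewrite ?kE ?(hi_lo, hihj); ring.
  by have [kE|kj] := eqVneq k (hi j); rewrite ?kE ?hjli ?hjhi //; ring.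
- move=> i j ij.
  have d : [/\ (lo i == lo j) = false, (lo i == hi j) = false,
      (hi i == lo j) = false & (hi i == hi j) = false].
    have ij' := ltnW ij.
    by split; rewrite -val_eqE /= ltn_eqF // ?ltnS // ltnW.
  case: d => d1 d2 d3 d4; have d5 := d1; have d6 := d2; have d7 := d3; have d8 := d4.
  rewrite eq_sym in d5; rewrite eq_sym in d6; rewrite eq_sym in d7; rewrite eq_sym in d8.
  apply: linear_eq => v; apply/matrixP => k z; rewrite (ord1 z) /=.
  rewrite !block2E !(d1, d2, d3, d4, d5, d6, d7, d8).
  have [kE|kl] := eqVneq k (lo i); first by rewrite ?kE !(d1, d2).
  have [kE|kh] := eqVneq k (hi i); first by rewrite ?kE !(d3, d4).
  by [].
Qed.

Definition burau : functor beta (Mod K) := braid_functor burau_datum.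

Lemma burau_gen n (i : 'I_n.-1) :
  fmap burau (Beta (sigma i)) = mulmx_lin (burau_mx q i).
Proof. exact: (braid_act_gen burau_datum i). Qed.

End Burau.

Section LongMoody.
Variables (K : comNzRingType).

Section Object.
Variable F : functor beta (Mod K).
Local Notation FM n := (F n : lmodType K).

(* K[F_n] acts on F(n+1) through varsigma_{n,1}. *)
Definition lm_act (n : nat) (a : group_ring K 'F^n) (v : FM n.+1) : FM n.+1 :=
  mext (fun g => fmap F (Beta (varsigma n g)) v) a.

Definition lm_fobj (n : nat) : Mod K :=
  balanced_tensor (@aug_mul K 'F^n) (@lm_act n).

Fact lm_compat n (s : 'B^n) : tensor_compat (@aug_mul K 'F^n) (@lm_act n)
  (@aug_mul K 'F^n) (@lm_act n)
  (@aug_map K _ _ (artin_rep s)) (fmap F (Beta (shift n s))).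
Proof.
exists (@gr_map K _ _ (artin_rep s)); split=> [m a|a v]; first exact: aug_map_mul.
move: a; apply: gr_ext => [||g].
- exact: linear_comp (linearP _) (mext_linear _).
- exact: linear_comp (mext_linear _) (gr_map_linear _).
rewrite gr_mapU /lm_act !mextU1.
have := fmapM F (Beta (shift n s)) (Beta (varsigma n g)).
have := fmapM F (Beta (varsigma n (artin_rep s g))) (Beta (shift n s)).
rewrite /= equivariance => -> /(congr1 (fun f : {linear _ -> _} => f v)) /=.
by move=> <-.
Qed.

Definition lm_tens (n : nat) (x : aug_ideal K 'F^n) (v : FM n.+1) :
  (lm_fobj n : lmodType K) := tens (@aug_mul K 'F^n) (@lm_act n) x v.

Definition lm_fmap m n (f : beta_hom m n) : {linear lm_fobj m -> lm_fobj n} :=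
  match f in beta_hom m n return {linear lm_fobj m -> lm_fobj n} with
  | @Beta n s => tensor_map (lm_compat s)
  end.

Lemma lm_fmap_tens n (s : 'B^n) (x : aug_ideal K 'F^n) (v : FM n.+1) :
  lm_fmap (Beta s) (lm_tens x v) =
    lm_tens (@aug_map K _ _ (artin_rep s) x) (fmap F (Beta (shift n s)) v).
Proof. exact: (tensor_mapE (lm_compat s)). Qed.

Fact lm_fmap1 n : lm_fmap (beta_id n) = lin_id _.
Proof.
have E1 (x : aug_ideal K 'F^n) : @aug_map K _ _ (artin_rep (1%g : 'B^n)) x = x.
  by apply: val_inj; apply: gr_map_id => g; rewrite artin_rep1.
have E2 : fmap F (Beta (shift n (1%g : 'B^n))) = lin_id _.
  by rewrite mult1; exact: (fmap1 F n.+1).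
apply/linear_eq/bt_ext => m v.
by apply: etrans (tensor_mapE (lm_compat (1%g : 'B^n)) m v) _; rewrite E1 E2.
Qed.

Fact lm_fmapM m n p (g : beta_hom n p) (f : beta_hom m n) :
  lm_fmap (beta_comp g f) = lin_comp (lm_fmap g) (lm_fmap f).
Proof.
case: g f => {p}n t f; case: f t => {m n} n s t.
have E1 (x : aug_ideal K 'F^n) : @aug_map K _ _ (artin_rep (t * s)%g) x =
    @aug_map K _ _ (artin_rep t) (@aug_map K _ _ (artin_rep s) x).
  by apply: val_inj; apply: gr_map_comp => g; rewrite artin_repM.
have E2 : fmap F (Beta (shift n (t * s)%g)) =
    lin_comp (fmap F (Beta (shift n t))) (fmap F (Beta (shift n s))).
  by rewrite multM; exact: (fmapM F (Beta (shift n t)) (Beta (shift n s))).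
apply/linear_eq/bt_ext => m v.
apply: etrans (tensor_mapE (lm_compat (t * s)%g) m v) _; apply: esym.
apply: etrans (congr1 (lm_fmap (Beta t)) (tensor_mapE (lm_compat s) m v)) _.
by apply: etrans (tensor_mapE (lm_compat t) _ _) _; rewrite E1 E2.
Qed.

Definition LM1_obj : functor beta (Mod K) := @Functor beta (Mod K) lm_fobj lm_fmap lm_fmap1 lm_fmapM.

End Object.

Section Morphism.
Variables (F G : functor beta (Mod K)) (eta : nat_trans F G).

Fact lm_nat_compat n : tensor_compat (@aug_mul K 'F^n) (@lm_act F n)
  (@aug_mul K 'F^n) (@lm_act G n) (lin_id _) (eta n.+1).
Proof.
exists id; split=> // a v; move: a; apply: gr_ext => [||g].
- exact: linear_comp (linearP _) (mext_linear _).
- exact: mext_linear.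
rewrite /lm_act !mextU1.
by have := natural eta (Beta (varsigma n g)) => /(congr1 (fun f : {linear _ -> _} => f v)) /= <-.
Qed.

Definition lm_nat n : {linear LM1_obj F n -> LM1_obj G n} :=
  tensor_map (lm_nat_compat n).

Fact lm_nat_natural m n (f : beta_hom m n) :
  lin_comp (lm_fmap G f) (lm_nat m) = lin_comp (lm_nat n) (lm_fmap F f).
Proof.
case: f => {m}n s; apply/linear_eq/bt_ext => m v.
have E : fmap G (Beta (shift n s)) (eta n.+1 v) =
    eta n.+1 (fmap F (Beta (shift n s)) v).
  exact: (congr1 (fun f : {linear (F n.+1 : lmodType K) -> (G n.+1 : lmodType K)} => f v)
    (natural eta (Beta (shift n s)))).
apply: etrans (congr1 (lm_fmap G (Beta s)) (tensor_mapE (lm_nat_compat n) m v)) _.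
apply: etrans (tensor_mapE (lm_compat G s) _ _) _; apply: esym.
apply: etrans (congr1 (lm_nat n) (tensor_mapE (lm_compat F s) m v)) _.
apply: etrans (tensor_mapE (lm_nat_compat n) _ _) _.
by rewrite E.
Qed.

Definition LM1_hom : nat_trans (LM1_obj F) (LM1_obj G) :=
  @NatTrans beta (Mod K) (LM1_obj F) (LM1_obj G) lm_nat lm_nat_natural.

End Morphism.

Definition LM1 : functor (Fct beta (Mod K)) (Fct beta (Mod K)).
Proof.
refine (@Functor (Fct beta (Mod K)) (Fct beta (Mod K)) LM1_obj LM1_hom _ _).
- move=> F; apply: nat_trans_eq => n; apply/linear_eq/bt_ext => m v.
  exact: tensor_mapE.
- move=> F G H b a; apply: nat_trans_eq => n; apply/linear_eq/bt_ext => m v.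
  apply: etrans (tensor_mapE _ _ _) _; apply: esym.
  apply: etrans (congr1 (lm_nat b n) (tensor_mapE (lm_nat_compat a n) _ _)) _.
  exact: tensor_mapE.
Defined.

End LongMoody.

Arguments lm_tens {K} F {n} x v.

(* Main.v *)
(* The map g |-> (d_1 g, ..., d_n g) of Fox derivatives with
   g - 1 = \sum_k (g_k - 1) d_k(g), evaluated at g_k |-> q, satisfies
   D (g h) = q^(deg h) D g + D h.  Since every varsigma(g_k) is conjugate to the
   square of an Artin generator, F_n acts on t\mathfrak X(n+1) through
   g_k |-> q = t^2, so (g - 1) (x) v |-> v D g is well defined; the Fox expansion
   of g - 1 shows that it is the inverse of w |-> \sum_k (g_k - 1) (x) w_k.  A
   generator sigma_i acts on the factor K by t, which the twist by t^-1 cancels,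
   and D (a(sigma_i) g_k) is the k-th column of the Burau matrix. *)
From HB Require Import structures.
From mathcomp Require Import all_boot all_order all_algebra.
From mathcomp Require Import finmap monalg complex boolp reals.
From mathcomp Require Import ring.
Require Import Defs.

Import GRing.Theory.
Local Open Scope ring_scope.

Set Implicit Arguments.
Unset Strict Implicit.
Unset Printing Implicit Defensive.

(** * Isomorphisms in functor categories and naturality over [beta] *)

(** Inverting the components of a natural transformation reverses its naturality squares, so
    inverses chosen point by point are again natural. *)
Lemma pointwise_iso (C D : category) (F G : functor C D) (a : @hom (Fct C D) F G) :
  (forall x, is_iso (nat_app a x)) -> is_iso a.
Proof.
move=> a_iso; pose b x := projT1 (cid (a_iso x)).
have ba x : compc (b x) (nat_app a x) = idc (F x) := (projT2 (cid (a_iso x))).1.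
have ab x : compc (nat_app a x) (b x) = idc (G x) := (projT2 (cid (a_iso x))).2.
have b_natural x y (f : hom x y) :
    compc (fmap F f) (b x) = compc (b y) (fmap G f).
  rewrite -[LHS]comp1c -(ba y) -compcA (compcA (nat_app a y)) -natural.
  by rewrite -compcA ab compc1.
by exists (NatTrans b_natural); split; apply: nat_trans_eq => x /=; rewrite ?ab ?ba.
Qed.

(** The braids for which the naturality square commutes are closed under products and inverses, and
    [beta] has only endomorphisms, so the Artin generators suffice. *)
Lemma braid_natural (C : category) (F G : functor beta C)
    (eta : forall n : nat, hom (F n) (G n)) :
  (forall n (i : 'I_n.-1), compc (fmap G (Beta (sigma i))) (eta n) =
     compc (eta n) (fmap F (Beta (sigma i)))) ->
  forall (m n : beta) (f : hom m n), compc (fmap G f) (eta m) = compc (eta n) (fmap F f).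
Proof.
move=> eta_gen m n [k s] {m n}; move: s; apply: braid_ind => [i||s t hs ht|s hs].
- exact: eta_gen.
- by have := fmap1 F k; have := fmap1 G k; rewrite /= => -> ->; rewrite comp1c compc1.
- have := fmapM F (Beta s) (Beta t); have := fmapM G (Beta s) (Beta t).
  by rewrite /= => -> ->; rewrite -compcA ht !compcA hs.
- have V (H : functor beta C) : compc (fmap H (Beta s)) (fmap H (Beta s^-1%g)) = idc _ /\
      compc (fmap H (Beta s^-1%g)) (fmap H (Beta s)) = idc _.
    split; rewrite -fmapM /= ?mulgV ?mulVg; exact: (fmap1 H k).
  (* Insert F(s) F(s^-1) on the right, carry F(s) across [eta] with [hs], and cancel G(s^-1) G(s) on
     the left. *)
  rewrite -[LHS]compc1 -(V F).1 -!compcA (compcA (eta k)) -hs.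
  by rewrite !compcA (V G).2 comp1c.
Qed.

(** * Fox derivatives evaluated at g_k = q, and the Burau matrices *)

Section FoxCalculus.
Variables (K : comUnitRingType) (q : K) (qU : q \is a GRing.unit) (n : nat).

(* [(c, v)] is the affine map [x |-> c *: x + v], and [aff_mul a b] applies [a]
   first.  The letter of [g_k] acts by [x |-> q *: x + e_k], so that the
   translation part of a word is its vector of right-handed Fox derivatives. *)
Definition aff_mul (a b : K * 'cV[K]_n) : K * 'cV[K]_n :=
  (a.1 * b.1, b.1 *: a.2 + b.2).

Definition aff_letter (l : letter 'I_n) : K * 'cV[K]_n :=
  if l.2 then (q^-1, - (q^-1 *: delta_mx l.1 0)) else (q, delta_mx l.1 0).

Fact aff_mulA : associative aff_mul.
Proof.
move=> a b c; rewrite /aff_mul /=; congr pair; first exact: mulrA.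
by rewrite scalerDr scalerA addrA [c.1 * _]mulrC.
Qed.
Fact aff_mul1 : left_id (1, 0) aff_mul.
Proof. by case=> c v; rewrite /aff_mul /= mul1r scaler0 add0r. Qed.
Fact aff_mulr1 : right_id (1, 0) aff_mul.
Proof. by case=> c v; rewrite /aff_mul /= mulr1 scale1r addr0. Qed.
Fact aff_letterV l : aff_mul (aff_letter l) (aff_letter (linv l)) = (1, 0).
Proof.
case: l => k [] /=; rewrite /aff_mul /aff_letter /= (mulVr qU, mulrV qU);
  by rewrite ?scalerN ?scalerA ?(mulrV qU) ?scale1r ?addNr ?subrr.
Qed.

Definition fox_pair (g : 'F^n) : K * 'cV[K]_n :=
  weval aff_mul (1, 0) aff_letter (repr g).
Definition fox_char (g : 'F^n) : K := (fox_pair g).1.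
Definition fox (g : 'F^n) : 'cV[K]_n := (fox_pair g).2.

Lemma fox_pairM g h : fox_pair (g * h)%g = aff_mul (fox_pair g) (fox_pair h).
Proof.
by apply: weval_mul; [exact: aff_mulA|exact: aff_mul1|exact: aff_mulr1|
  exact: aff_letterV|].
Qed.
Lemma fox_pair1 : fox_pair 1%g = (1, 0).
Proof.
by apply: weval_one; [exact: aff_mulA|exact: aff_mul1|exact: aff_mulr1|
  exact: aff_letterV|].
Qed.
Lemma fox_pair_gen k : fox_pair (fgen k) = (q, delta_mx k 0).
Proof.
by apply: weval_gen; [exact: aff_mulA|exact: aff_mul1|exact: aff_mulr1|
  exact: aff_letterV|].
Qed.

Lemma fox_charM g h : fox_char (g * h)%g = fox_char g * fox_char h.
Proof. by rewrite /fox_char fox_pairM. Qed.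
Lemma fox_char1 : fox_char 1%g = 1. Proof. by rewrite /fox_char fox_pair1. Qed.
Lemma fox_char_gen k : fox_char (fgen k) = q.
Proof. by rewrite /fox_char fox_pair_gen. Qed.
Lemma fox_charV g : fox_char g * fox_char g^-1%g = 1.
Proof. by rewrite -fox_charM mulgV fox_char1. Qed.
Lemma fox_charV_gen k : fox_char (fgen k)^-1%g = q^-1.
Proof. by apply: (mulrI qU); rewrite -{1}(fox_char_gen k) fox_charV mulrV. Qed.

Lemma foxM g h : fox (g * h)%g = fox_char h *: fox g + fox h.
Proof. by rewrite /fox fox_pairM. Qed.
Lemma fox1 : fox 1%g = 0. Proof. by rewrite /fox fox_pair1. Qed.
Lemma fox_gen k : fox (fgen k) = delta_mx k 0.
Proof. by rewrite /fox fox_pair_gen. Qed.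
Lemma foxV g : fox g^-1%g = - (fox_char g^-1%g *: fox g).
Proof. by apply/eqP; rewrite -addr_eq0 addrC -foxM mulgV fox1. Qed.

(** Only k = [hi i] involves a product: writing l and h for the generators at [lo i] and [hi i], the
    product rule gives D(h^-1 l h) = q e_l + (1 - q) e_h, the second column of the block. *)
Lemma fox_artin_gen (i : 'I_n.-1) k :
  fox (artin_gen i (fgen k)) = burau_mx q i *m fox (fgen k).
Proof.
apply/matrixP => j z; rewrite (ord1 z) /burau_mx block2E !fox_gen !mxE !eqxx !andbT.
have [->|kl] := eqVneq k (lo i).
  rewrite artin_lo fox_gen !mxE eqxx hi_lo !andbT.
  case: (eqVneq j (lo i)) => [->|jl]; first by rewrite lo_hi /=; ring.
  by case: (eqVneq j (hi i)) => _ /=; ring.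
have [->|kh] := eqVneq k (hi i).
  rewrite artin_hi !(foxM, foxV, fox_charM, fox_charV_gen, fox_gen, fox_char_gen).
  rewrite !mxE ?(eqxx, lo_hi) ?andbT; have qV := mulrV qU.
  case: (eqVneq j (lo i)) => [->|jl]; first by rewrite lo_hi /=; ring: qV.
  by case: (eqVneq j (hi i)) => _ /=; ring: qV.
rewrite artin_other // fox_gen mxE !andbT !mulr0 !addr0.
case: (eqVneq j (lo i)) => [->|_]; first by rewrite eq_sym (negbTE kl).
by case: (eqVneq j (hi i)) => [->|//]; rewrite eq_sym (negbTE kh).
Qed.

(** The automorphism sends every generator to a conjugate of a generator, and the character takes
    the same value q on all generators. *)
Lemma fox_char_artin (i : 'I_n.-1) g : fox_char (artin_gen i g) = fox_char g.
Proof.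
have gen k : fox_char (artin_gen i (fgen k)) = fox_char (fgen k).
  rewrite artin_genE /artin_gen_val; case: eqVneq => _; first by rewrite !fox_char_gen.
  case: eqVneq => // _; rewrite !fox_charM !fox_char_gen fox_charV_gen.
  by rewrite mulVr // mul1r.
move: g; apply: pres_ind => [|k x IH|k x IH]; first by rewrite mult1.
  by rewrite multM !fox_charM IH gen.
rewrite multM multV !fox_charM IH; congr (_ * _); apply: (mulrI qU).
by rewrite -{1}(fox_char_gen k) -gen fox_charV -(fox_char_gen k) fox_charV.
Qed.

(** As the character is invariant under [artin_gen i], both sides obey the same twisted product rule
    in [g], and they agree on generators. *)
Lemma fox_artin (i : 'I_n.-1) g : fox (artin_gen i g) = burau_mx q i *m fox g.
Proof.
move: g; apply: pres_ind => [|k x IH|k x IH]; first by rewrite mult1 fox1 mulmx0.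
  by rewrite multM !foxM IH fox_artin_gen fox_char_artin mulmxDr -scalemxAr.
rewrite multM multV !foxM !foxV IH fox_artin_gen fox_char_artin -multV fox_char_artin.
by rewrite mulmxDr -scalemxAr mulmxN -scalemxAr.
Qed.

Definition gr_fox (x : group_ring K 'F^n) : 'cV[K]_n := mext fox x.
Definition gr_char (x : group_ring K 'F^n) : K^o := mext (fox_char : _ -> K^o) x.

Lemma gr_foxU g : gr_fox (gr_of K g) = fox g. Proof. exact: mextU1. Qed.
Lemma gr_charU g : gr_char (gr_of K g) = fox_char g. Proof. exact: mextU1. Qed.
Lemma gr_fox_linear : linear gr_fox. Proof. exact: mext_linear. Qed.
HB.instance Definition _ := GRing.isLinear.Build K (group_ring K 'F^n) 'cV[K]_n *:%R
  gr_fox gr_fox_linear.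
Lemma gr_char_linear : linear gr_char. Proof. exact: mext_linear. Qed.

Lemma gr_fox_artin (i : 'I_n.-1) x :
  gr_fox (gr_map (artin_gen i) x) = burau_mx q i *m gr_fox x.
Proof.
move: x; apply: gr_ext => [||g].
- exact: linear_comp gr_fox_linear (gr_map_linear _).
- by move=> c x x'; rewrite gr_fox_linear mulmxDr -scalemxAr.
by rewrite gr_mapU !gr_foxU fox_artin.
Qed.

(** Bilinear extension of [foxM], where the coefficient 1 of D h is the augmentation of g. On the
    augmentation ideal the second term vanishes, and [gr_fox] turns right multiplication by [a] into
    the scalar [gr_char a]. *)
Lemma gr_foxM x a : gr_fox (x * a) = gr_char a *: gr_fox x + gr_aug x *: gr_fox a.
Proof.
move: x; apply: gr_ext => [||g].
- exact: linear_comp gr_fox_linear (@gr_mul_linear_l K _ a).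
- move=> c x x'; rewrite gr_fox_linear gr_aug_linear !scalerDr scalerDl addrACA.
  rewrite !scalerA [gr_char a * c]mulrC; congr (_ + _).
move: a; apply: gr_ext => [||h].
- exact: linear_comp gr_fox_linear (@gr_mul_linear_r K _ _).
- move=> c a a'; rewrite gr_fox_linear gr_char_linear !scalerDr scalerDl addrACA.
  rewrite !scalerA [gr_aug _ * c]mulrC; congr (_ + _).
by rewrite gr_mulE !gr_foxU gr_charU gr_augU scale1r foxM.
Qed.

End FoxCalculus.

(** * The isomorphism of LM_1(yX)(n) with K^n and the action of the generators *)

Section LongMoodyUnit.
Variables (K : comUnitRingType) (y : K) (yU : y \is a GRing.unit).
Local Notation U := (unit_functor yU).
Local Notation q := (y ^+ 2).
Variable (qU : q \is a GRing.unit).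

(** A linear endomorphism of K is multiplication by its value at 1, so this is the scalar by which
    [s] acts. *)
Definition unit_char n (s : 'B^n) : K := (fmap U (Beta s) : {linear K^o -> K^o}) 1.

Lemma unit_charE n (s : 'B^n) (v : K^o) :
  (fmap U (Beta s) : {linear K^o -> K^o}) v = unit_char s * v.
Proof.
rewrite mulrC -[v in LHS]mulr1.
exact: (linearZ_LR (fmap U (Beta s) : {linear K^o -> K^o}) v (1 : K^o)).
Qed.

Lemma unit_charM n (s t : 'B^n) : unit_char (s * t)%g = unit_char s * unit_char t.
Proof.
have := fmapM U (Beta s) (Beta t) => /(congr1 (fun f : {linear K^o -> K^o} => f 1)).
by rewrite -unit_charE.
Qed.
Lemma unit_char1 n : unit_char (1%g : 'B^n) = 1.
Proof. by have := fmap1 U n => /(congr1 (fun f : {linear K^o -> K^o} => f 1)). Qed.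
Lemma unit_char_gen n (i : 'I_n.-1) : unit_char (sigma i) = y.
Proof. by rewrite /unit_char unit_functor_gen /= [LHS]mulr1. Qed.
Lemma unit_charV n (s : 'B^n) : unit_char s * unit_char s^-1%g = 1.
Proof. by rewrite -unit_charM mulgV unit_char1. Qed.

Lemma unit_char_shift n (i : 'I_n.-1) : unit_char (shift n (sigma i)) = y.
Proof.
rewrite shift_gen -[i.+1]/(nat_of_ord (hi i : 'I_n.+1.-1)).
by rewrite sigman_ord unit_char_gen.
Qed.

(** Each [varsigma n (fgen k)] is a conjugate of a squared Artin generator; scalars commute, so it
    acts by y^2. *)
Lemma unit_char_varsigma n (g : 'F^n) : unit_char (varsigma n g) = fox_char q g.
Proof.
have gen k : unit_char (varsigma n (fgen k)) = fox_char q (fgen k).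
  rewrite fox_char_gen // varsigma_fgen !unit_charM mulrAC [X in X * _]mulrC.
  (* The ordinal [k] also indexes a generator on n + 1 strands, as [n.+1.-1] reduces to [n]. *)
  by rewrite unit_charV mul1r (sigman_ord (k : 'I_n.+1.-1)) unit_char_gen.
move: g; apply: pres_ind => [|k x IH|k x IH].
- by rewrite mult1 unit_char1 fox_char1.
- by rewrite multM unit_charM fox_charM // IH gen.
- rewrite multM unit_charM fox_charM // IH multV; congr (_ * _).
  apply: (mulrI qU); rewrite -{1}(fox_char_gen qU k) -gen unit_charV.
  by rewrite -{1}(fox_char_gen qU k) fox_charV.
Qed.

Lemma lm_act_unit n (a : group_ring K 'F^n) (v : K^o) :
  lm_act (F := U) a v = gr_char q a *: v :> K^o.
Proof.
move: a; apply: gr_ext => [||g].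
- exact: mext_linear.
- by move=> c a b; rewrite gr_char_linear scalerDl scalerA.
rewrite /lm_act mextU1 gr_charU -unit_char_varsigma; exact: unit_charE.
Qed.

Definition aug_fox n (x : aug_ideal K 'F^n) (v : K^o) : 'cV[K]_n :=
  v *: gr_fox q (aug_val x).

Fact aug_fox_linear_l n v : linear (fun x : aug_ideal K 'F^n => aug_fox x v).
Proof. by move=> c x x'; rewrite /aug_fox gr_fox_linear scalerDr !scalerA mulrC. Qed.
Fact aug_fox_linear_r n (x : aug_ideal K 'F^n) : linear (aug_fox x).
Proof. by move=> c v w; rewrite /aug_fox scalerDl scalerA. Qed.
(** The augmentation term of [gr_foxM] vanishes on the ideal, and [a] acts on the other factor by
    the same scalar [gr_char q a]. *)
Fact aug_fox_balanced n (x : aug_ideal K 'F^n) a v :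
  aug_fox (aug_mul x a) v = aug_fox x (lm_act (F := U) a v).
Proof.
rewrite lm_act_unit /aug_fox /= gr_foxM // aug_valP scale0r addr0 scalerA.
by rewrite mulrC.
Qed.

(** This is Lambda_n, given on the whole ideal by Fox derivatives; [lm_unit_iso_gen] recovers its
    values on the basis g_k - 1. *)
Definition lm_unit_iso n : {linear lm_fobj U n -> 'cV[K]_n} :=
  mklin (bt_lift_linear (@aug_fox_linear_l n) (@aug_fox_linear_r n) (@aug_fox_balanced n)).

Lemma lm_unit_isoE n (x : aug_ideal K 'F^n) (v : K^o) :
  lm_unit_iso n (lm_tens U x v) = v *: gr_fox q (aug_val x).
Proof.
exact: (bt_lift_tens (@aug_fox_linear_l n) (@aug_fox_linear_r n) (@aug_fox_balanced n)).
Qed.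

Lemma gr_fox_aug_gen n (g : 'F^n) : gr_fox q (aug_val (aug_gen K g)) = fox q g.
Proof. by rewrite /= linearB -gr_1E /= !gr_foxU fox1 // subr0. Qed.

Lemma lm_unit_iso_gen n (k : 'I_n) (v : K^o) :
  lm_unit_iso n (lm_tens U (aug_gen K (fgen k)) v) =
    \col_(j < n) (if j == k then v else 0).
Proof.
rewrite lm_unit_isoE gr_fox_aug_gen fox_gen //; apply/matrixP => j z.
by rewrite !mxE (ord1 z) eqxx andbT; case: eqP => _; rewrite ?mulr1 ?mulr0.
Qed.

Lemma lm_tens_linear_r n (x : aug_ideal K 'F^n) :
  linear (lm_tens U x : K^o -> lm_fobj U n).
Proof. by move=> c v w; rewrite /lm_tens tensDr tensZr. Qed.

Lemma lm_tens_linear_l n (v : K^o) :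
  linear (fun x : aug_ideal K 'F^n => lm_tens U x v : lm_fobj U n).
Proof. by move=> c x x'; rewrite /lm_tens tensDl tensZl. Qed.

Definition lm_unit_inv_fun n (w : 'cV[K]_n) : lm_fobj U n :=
  \sum_(k < n) lm_tens U (aug_gen K (fgen k)) (w k 0 : K^o).

Fact lm_unit_inv_linear n : linear (@lm_unit_inv_fun n).
Proof.
move=> c v w; rewrite /lm_unit_inv_fun scaler_sumr -big_split /=.
apply: eq_bigr => k _; rewrite !mxE; exact: lm_tens_linear_r.
Qed.

Definition lm_unit_inv n : {linear 'cV[K]_n -> lm_fobj U n} :=
  mklin (@lm_unit_inv_linear n).

Lemma lm_unit_invD n v w : lm_unit_inv n (v + w) = lm_unit_inv n v + lm_unit_inv n w.
Proof. exact: (linearD (lm_unit_inv n)). Qed.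

Lemma lm_unit_invN n v : lm_unit_inv n (- v) = - lm_unit_inv n v.
Proof. exact: (linearN (lm_unit_inv n)). Qed.

Lemma lm_unit_invK n (w : 'cV[K]_n) : lm_unit_iso n (lm_unit_inv n w) = w.
Proof.
apply: etrans (linear_sum (lm_unit_iso n) _ _ _) _.
apply/matrixP => j z; rewrite (ord1 z).
rewrite summxE (eq_bigr (fun k => if j == k then w k 0 else 0)) => [|k _].
  by rewrite -big_mkcond (big_pred1 j) // => k; rewrite eq_sym.
by rewrite [lm_unit_iso n _]lm_unit_iso_gen mxE.
Qed.

(** Write gh - 1 = (g - 1)h + (h - 1) and move h across the tensor sign, where it becomes a
    scalar. *)
Lemma lm_tens_augM n (g h : 'F^n) (v : K^o) :
  lm_tens U (aug_gen K (g * h)%g) v =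
  lm_tens U (aug_gen K g) (fox_char q h *: v : K^o) + lm_tens U (aug_gen K h) v.
Proof.
have -> : aug_gen K (g * h)%g = aug_mul (aug_gen K g) (gr_of K h) + aug_gen K h.
  by apply: val_inj; rewrite /= mulrBl mul1r gr_mulE addrA subrK.
rewrite /lm_tens tensDl tensA lm_act_unit gr_charU //.
Qed.

Lemma lm_tens_aug1 n (v : K^o) : lm_tens U (aug_gen K (1%g : 'F^n)) v = 0.
Proof.
have -> : aug_gen K (1%g : 'F^n) = 0 by apply: val_inj; rewrite /= -gr_1E subrr.
exact: (linear0 (mklin (lm_tens_linear_l v))).
Qed.

(** Fox's fundamental formula inside the tensor product: by [lm_tens_augM] and [foxM] both sides
    follow the same recursion on words in the generators. *)
Lemma lm_tens_aug_gen n (g : 'F^n) (v : K^o) :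
  lm_tens U (aug_gen K g) v = lm_unit_inv n (v *: fox q g).
Proof.
have gen k (w : K^o) : lm_tens U (aug_gen K (fgen k)) w =
    lm_unit_inv n (w *: fox q (fgen k)).
  rewrite -[RHS]/(lm_unit_inv_fun _) /lm_unit_inv_fun.
  rewrite (eq_bigr (fun j => if j == k then lm_tens U (aug_gen K (fgen j)) w else 0)).
    by rewrite -big_mkcond big_pred1_eq.
  move=> j _; have -> : (w *: fox q (fgen k)) j 0 = if j == k then w else 0.
    by rewrite fox_gen // !mxE eqxx andbT; case: eqP => _; rewrite ?mulr1 ?mulr0.
  case: eqP => // _; exact: (linear0 (mklin (lm_tens_linear_r _))).
move: g v; apply: pres_ind => [|k x IH|k x IH] v.
- rewrite lm_tens_aug1 fox1 // scaler0; exact/esym/(linear0 (lm_unit_inv n)).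
- rewrite lm_tens_augM IH [X in X + _]gen -lm_unit_invD (foxM qU (pgen _ k)).
  by rewrite scalerDr !scalerA (mulrC v).
rewrite lm_tens_augM IH (foxM qU (pgen _ k)^-1%g) scalerDr lm_unit_invD; congr (_ + _).
(* For an inverse letter, expand g_k^-1 g_k = 1. The vector carries the factor chi(g_k^-1), chi
   being [fox_char q], to cancel the chi(g_k) that the rule produces; this expresses the g_k^-1 - 1
   term through g_k - 1. *)
have := lm_tens_augM (pgen _ k)^-1%g (pgen _ k)
  (fox_char q (pgen _ k)^-1%g *: (fox_char q x *: v)).
rewrite mulVg lm_tens_aug1 scalerA (fox_charV qU) scale1r [X in _ + X]gen => /esym/eqP.
rewrite addr_eq0 => /eqP->.
rewrite -lm_unit_invN (foxV qU (pgen _ k)); apply: (congr1 (lm_unit_inv n)).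
move: (fox_char _ _) (fox _ _) (fox_char _ _) => a f b.
rewrite !scalerN !scalerA; congr (- (_ *: _)).
by rewrite -[RHS]mulrA [RHS]mulrC [a * b]mulrC.
Qed.

(** The projection a - aug(a) 1 retracts the group ring onto its augmentation ideal, so that linear
    identities on the ideal can be checked on group elements, each g going to g - 1. *)
Fact aug_proj_subproof n (a : group_ring K 'F^n) :
  a - (gr_aug a : K) *: gr_of K 1%g \in @aug_pred K 'F^n.
Proof. by rewrite inE linearB linearZ /= gr_augU [_ *: _]mulr1 subrr. Qed.
Definition aug_proj n (a : group_ring K 'F^n) : aug_ideal K 'F^n :=
  AugIdeal (aug_proj_subproof a).

Fact aug_proj_linear n : linear (@aug_proj n).
Proof.
move=> c a b; apply: val_inj; rewrite /= gr_aug_linear scalerDl opprD addrACA.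
by rewrite scalerBr scalerA.
Qed.

Lemma aug_proj_val n (x : aug_ideal K 'F^n) : aug_proj (aug_val x) = x.
Proof. by apply: val_inj; rewrite /= aug_valP scale0r subr0. Qed.

Lemma aug_proj_of n (g : 'F^n) : aug_proj (gr_of K g) = aug_gen K g.
Proof. by apply: val_inj; rewrite /= gr_augU scale1r. Qed.

Lemma lm_tens_proj n (a : group_ring K 'F^n) (v : K^o) :
  lm_tens U (aug_proj a) v = lm_unit_inv n (v *: gr_fox q a).
Proof.
move: a; apply: gr_ext => [||g].
- by move=> c a b; rewrite aug_proj_linear lm_tens_linear_l.
- move=> c a b; rewrite gr_fox_linear scalerDr scalerA mulrC -scalerA.
  exact: (linearP (lm_unit_inv n)).
by rewrite gr_foxU aug_proj_of lm_tens_aug_gen.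
Qed.

Lemma lm_unit_isoK n : lin_comp (lm_unit_inv n) (lm_unit_iso n) = lin_id _.
Proof.
apply/linear_eq/bt_ext => x v.
apply: etrans (congr1 (lm_unit_inv n) (lm_unit_isoE x v)) _.
by rewrite -lm_tens_proj aug_proj_val.
Qed.

(** On the ideal, sigma_i acts by [artin_gen i], which Fox derivatives turn into the Burau matrix;
    on the factor K it acts through [shift], again a generator, hence by y. *)
Lemma lm_unit_natural n (i : 'I_n.-1) :
  lin_comp (lm_unit_iso n) (lm_fmap U (Beta (sigma i))) =
  lin_comp (mulmx_lin (y *: burau_mx q i)) (lm_unit_iso n).
Proof.
apply/linear_eq/bt_ext => x v.
apply: etrans (congr1 (lm_unit_iso n) (lm_fmap_tens (sigma i) x v)) _.
apply: etrans (lm_unit_isoE _ _) _; apply: esym.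
apply: etrans (congr1 (mulmx_lin (y *: burau_mx q i)) (lm_unit_isoE x v)) _.
rewrite artin_rep_gen unit_charE unit_char_shift /= gr_fox_artin //.
by rewrite -scalemxAr -scalemxAl !scalerA mulrC.
Qed.

End LongMoodyUnit.

(** * The twist by y^-1 and the natural isomorphism with the Burau functor *)

Section Twist.
Variables (K : comUnitRingType) (y : K) (yU : y \is a GRing.unit).
Local Notation U := (unit_functor yU).
Local Notation q := (y ^+ 2).
Variables (qU : q \is a GRing.unit) (yVU : y^-1 \is a GRing.unit).

Lemma lm_unit_is_iso n :
  @is_iso (Mod K) (lm_fobj U n) (col_obj K n) (lm_unit_iso yU qU n).
Proof.
exists (lm_unit_inv yU n); split; first exact: lm_unit_isoK.
by apply: linear_eq => w; exact: lm_unit_invK.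
Qed.

(** The bilinear map behind the canonical isomorphism of K (x) M with M, followed by Lambda_n. *)
Definition scaled_iso n (a : K^o) (x : lm_fobj U n) : 'cV[K]_n :=
  a *: lm_unit_iso yU qU n x.

Fact scaled_iso_linear_l n (x : lm_fobj U n) : linear ((@scaled_iso n)^~ x).
Proof. by move=> c a b; rewrite /scaled_iso scalerDl scalerA. Qed.
Fact scaled_iso_linear_r n (a : K^o) : linear (@scaled_iso n a).
Proof.
move=> c x x'; rewrite /scaled_iso (linearP (lm_unit_iso yU qU n)) scalerDr !scalerA.
by rewrite mulrC.
Qed.
Fact scaled_iso_balanced n (a : K^o) (c : K) (x : lm_fobj U n) :
  scaled_iso (scale_right a c) x = scaled_iso a (scale_left c x).
Proof.
rewrite /scaled_iso /scale_right /scale_left (linearZ_LR (lm_unit_iso yU qU n)).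
by rewrite scalerA [in RHS]mulrC.
Qed.

Definition twist_iso n : {linear tensor K^o (lm_fobj U n) -> 'cV[K]_n} :=
  mklin (bt_lift_linear (@scaled_iso_linear_l n) (@scaled_iso_linear_r n)
    (@scaled_iso_balanced n)).

Lemma twist_isoE n (a : K^o) (x : lm_fobj U n) :
  twist_iso n (tensK a x) = a *: lm_unit_iso yU qU n x.
Proof.
exact: (bt_lift_tens (@scaled_iso_linear_l n) (@scaled_iso_linear_r n)
  (@scaled_iso_balanced n)).
Qed.

Fact twist_inv_linear n :
  linear (fun w : 'cV[K]_n => tensK (1 : K^o) (lm_unit_inv yU n w)).
Proof. by move=> c v w; rewrite (linearP (lm_unit_inv yU n)) /tensK tensDr tensZr. Qed.

(** Since a (x) x = a (1 (x) x), the inverse is w |-> 1 (x) Lambda_n^-1(w). *)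
Lemma twist_is_iso n :
  @is_iso (Mod K) (tensor K^o (lm_fobj U n)) (col_obj K n) (twist_iso n).
Proof.
exists (mklin (@twist_inv_linear n)); split.
  apply/linear_eq/bt_ext => a x.
  apply: etrans (congr1 (mklin (@twist_inv_linear n)) (twist_isoE a x)) _.
  apply: etrans (linearZ_LR (mklin (@twist_inv_linear n)) a _) _.
  have E : lm_unit_inv yU n (lm_unit_iso yU qU n x) = x.
    exact: (congr1 (fun f : {linear _ -> _} => f x) (lm_unit_isoK yU qU n)).
  apply: etrans (congr1 (fun z => a *: tensK (1 : K^o) z) E) _.
  by rewrite -[LHS]tensZl [_ *: _]mulr1.
apply: linear_eq => w; apply: etrans (twist_isoE _ _) _.
by rewrite lm_unit_invK scale1r.
Qed.

(** The twist contributes y^-1 on the left factor, which cancels the y of [lm_unit_natural]. *)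
Lemma twist_natural (n : nat) (i : 'I_n.-1) :
  @compc (Mod K) _ _ _ (fmap (burau qU) (Beta (sigma i))) (twist_iso n) =
  @compc (Mod K) _ _ _ (twist_iso n)
    (fmap (unit_twist yVU (LM1 K U)) (Beta (sigma i))).
Proof.
apply/linear_eq/bt_ext => a x; rewrite burau_gen.
apply: etrans (congr1 (mulmx_lin (burau_mx q i)) (twist_isoE a x)) _; apply: esym.
apply: etrans (congr1 (twist_iso n) (tensor_mapE _ a x)) _.
apply: etrans (twist_isoE _ _) _.
have -> : lm_unit_iso yU qU n (lm_fmap U (Beta (sigma i)) x) =
    (y *: burau_mx q i) *m lm_unit_iso yU qU n x.
  exact: (congr1 (fun f : {linear _ -> _} => f x) (lm_unit_natural yU qU i)).
rewrite unit_functor_gen /= -scalemxAr -scalemxAl scalerA.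
by rewrite [_ * y]mulrC mulrA mulrV // mul1r.
Qed.

Definition twist_trans : @hom (Fct beta (Mod K)) (unit_twist yVU (LM1 K U)) (burau qU) :=
  @NatTrans beta (Mod K) _ _ _
    (@braid_natural (Mod K) (unit_twist yVU (LM1 K U)) (burau qU) twist_iso twist_natural).

End Twist.

(** [Lambda] is a mere family of maps, as it intertwines the generators only up to the factor t;
    [Phi], which absorbs the twist, is the natural isomorphism that it induces. *)
Theorem proposition2p30 (R : realType) :
  let K : comUnitRingType := laurent R[i] in
  let tX : functor beta (Mod K) := unit_functor (laurentX_unit R[i]) in
  let LMtX : functor beta (Mod K) := LM1 K tX in
  let Bur : functor beta (Mod K) := burau (laurentX2_unit R[i]) in
  exists Lambda : forall n : nat, hom (LMtX n) (Bur n),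
    (forall n : nat, is_iso (Lambda n)) /\
    (forall (n : nat) (k : 'I_n) (v : K),
      Lambda n (lm_tens tX (aug_gen K (fgen k)) v) =
        \col_(j < n) (if j == k then v else 0)) /\
    exists Phi : @hom (Fct beta (Mod K)) (unit_twist (laurentXV_unit R[i]) LMtX) Bur,
      is_iso Phi /\
      forall (n : nat) (a : K) (x : LMtX n),
        Phi n (@tensK K K^o (LMtX n) a x) = a *: Lambda n x.
Proof.
move=> K tX LMtX Bur.
(* Take y = t: the Burau parameter is then y^2 = t^2 and the twist is by y^-1 = t^-1. *)
exists (lm_unit_iso (laurentX_unit R[i]) (laurentX2_unit R[i])).
split; first exact: lm_unit_is_iso.
split; first exact: lm_unit_iso_gen.
exists (twist_trans (laurentX_unit R[i]) (laurentX2_unit R[i]) (laurentXV_unit R[i])).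
split; first by apply: pointwise_iso => n; exact: twist_is_iso.
exact: twist_isoE.
Qed.
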